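(* Let $\pi,\tilde g,\gamma,\hat\pi,z,\hat z,\nu_\pi$ and $\hat T_\sharp\mu_{\rm uni}$ be as in the context, and let $\epsilon\ge0$. Suppose that $$\|\tilde g-\sqrt{\pi}\|_{L^2_\lambda(\mathcal X)}\le\epsilon\qquad\text{and}\qquad \gamma\le\frac{1}{\lambda(\mathcal X)}\,\|\tilde g-\sqrt{\pi}\|^2_{L^2_\lambda(\mathcal X)} ,$$ and suppose further that $\sup_{x\in\mathcal X}\pi(x)/\hat\pi(x)<\infty$. Then the $\chi^2$-divergence of $\nu_\pi$ from $\hat T_\sharp\mu_{\rm uni}$ satisfies $$D_{\chi^2}\big(\nu_\pi\,\|\,\hat T_\sharp\mu_{\rm uni}\big)\le\Big(\nu_\pi\big(\pi^2/\hat\pi^2\big)^{1/2}+\big(\hat T_\sharp\mu_{\rm uni}\big)\big(\pi^2/\hat\pi^2\big)^{1/2}\Big)\,\frac{2\sqrt2\,\hat z}{z\sqrt z}\,\epsilon .$$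
   Context: $\mathcal X=\mathcal X_1\times\cdots\times\mathcal X_d$ with $\mathcal X_k\subseteq\mathbb R$. $\lambda(x)=\prod_{i=1}^d\lambda_i(x_i)$ is a nonnegative Lebesgue measurable product weight with $\lambda(\mathcal X)=\prod_i\int_{\mathcal X_i}\lambda_i(x_i)\,dx_i$ finite and positive. $\|f\|_{L^p_\lambda(\mathcal X)}=\big(\int_{\mathcal X}|f|^p\lambda\,dx\big)^{1/p}$. Target: $\pi:\mathcal X\to[0,\infty)$, $\pi\in L^1_\lambda(\mathcal X)$, $z=\int_{\mathcal X}\pi\lambda\,dx>0$; $\nu_\pi$ is the probability measure with density $\frac1z\pi\lambda$. Approximation: $\tilde g:\mathcal X\to\mathbb R$ in $L^2_\lambda(\mathcal X)$ has tensor-train form $\tilde g(x)=\mathsf G_1(x_1)\cdots\mathsf G_d(x_d)$ with $\mathsf G_k:\mathcal X_k\to\mathbb R^{r_{k-1}\times r_k}$, $r_0=r_d=1$. $\gamma>0$, $\hat\pi=\gamma+\tilde g^2$, $\hat z=\gamma\lambda(\mathcal X)+\int_{\mathcal X}\tilde g^2\lambda\,dx$, $\hat f=\frac1{\hat z}\hat\pi\lambda$. The squared inverse Rosenblatt transport $\hat T:[0,1]^d\to\mathcal X$ is the inverse of the lower-triangular map $(F_1(x_1),F_2(x_2|x_1),\ldots,F_d(x_d|x_1,\ldots,x_{d-1}))$ of marginal/conditional cumulative distribution functions of $\hat f$; with $\mu_{\rm uni}$ uniform on $[0,1]^d$, $\hat T_\sharp\mu_{\rm uni}$ is the probability measure with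 density $\hat f$. For a measure $\nu$ and function $h$, $\nu(h)=\int h\,d\nu$ and $\nu(h)^{1/2}=(\nu(h))^{1/2}$. For probability measures $\nu\ll\nu'$ with Lebesgue densities $p,q$, $D_{\chi^2}(\nu\|\nu')=\int(p/q)^2q\,dx-1$. *)

(* Defs.v *)
(* MathComp / MathComp-Analysis *)
From HB Require Import structures.
From mathcomp Require Import all_boot all_order all_algebra.
From mathcomp Require Import all_classical all_reals all_analysis.

Set Implicit Arguments.
Unset Strict Implicit.
Unset Printing Implicit Defensive.

Import Order.TTheory GRing.Theory Num.Theory.
Import numFieldNormedType.Exports.

Local Open Scope classical_set_scope.
Local Open Scope ring_scope.

Section borel_lebesgue.
Context {R : realType}.
Local Notation RT := (measurableTypeR R).

Definition tcons n (p : RT * n.-tuple RT) : n.+1.-tuple RT :=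
  [the n.+1.-tuple RT of p.1 :: p.2].

Definition tuncons n (x : n.+1.-tuple RT) : RT * n.-tuple RT :=
  (thead x, [tuple of behead x]).

Lemma tconsK n : cancel (@tcons n) (@tuncons n).
Proof.
move=> [a t]; rewrite /tcons /tuncons /=; congr pair.
by apply: val_inj.
Qed.

Lemma tunconsK n : cancel (@tuncons n) (@tcons n).
Proof. by move=> x; rewrite [RHS]tuple_eta. Qed.

Lemma measurable_tcons n : measurable_fun setT (@tcons n).
Proof. exact: (measurable_cons measurable_fst measurable_snd). Qed.

Lemma measurable_tuncons n : measurable_fun setT (@tuncons n).
Proof.
apply: measurable_fun_pair; last exact: measurable_behead.
exact: (@measurable_tnth _ RT n.+1 ord0).
Qed.

Section succ.
Context n (m : {sigma_finite_measure set (n.-tuple RT) -> \bar R}).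

Definition leb_succ : set (n.+1.-tuple RT) -> \bar R :=
  pushforward (lebesgue_measure \x m)%E (@tcons n).

Let leb_succ0 : leb_succ set0 = 0%E.
Proof. by rewrite /leb_succ /pushforward preimage_set0 measure0. Qed.

Let leb_succ_ge0 A : (0 <= leb_succ A)%E.
Proof. by rewrite /leb_succ /pushforward measure_ge0. Qed.

Let leb_succ_sigma_additive : semi_sigma_additive leb_succ.
Proof.
apply: (@measure_semi_sigma_additive _ _ _
  (measure_function_pushforward__canonical__measure_function_Measure
    (lebesgue_measure \x m)%E (@measurable_tcons n))).
Qed.

HB.instance Definition _ := isMeasure.Build _ _ _ leb_succ
  leb_succ0 leb_succ_ge0 leb_succ_sigma_additive.

Let leb_succ_sigma_finite : sigma_finite setT leb_succ.
Proof.
have /sigma_finiteP[F [TF ndF Foo]] := sigma_finiteT (@lebesgue_measure R).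
have /sigma_finiteP[G [TG ndG Goo]] := sigma_finiteT m.
exists (fun k => (@tuncons n) @^-1` (F k `*` G k)).
  apply/esym/seteqP; split => // x _.
  have [i _ Fi] : (\bigcup_i F i) (tuncons x).1 by rewrite -TF.
  have [j _ Gj] : (\bigcup_j G j) (tuncons x).2 by rewrite -TG.
  exists (maxn i j) => //; split.
    by move: Fi; apply/subsetPset/ndF/leq_maxl.
  by move: Gj; apply/subsetPset/ndG/leq_maxr.
move=> k; have [mFk Fk] := Foo k; have [mGk Gk] := Goo k; split.
  rewrite -[X in measurable X]setTI.
  by apply: measurable_tuncons => //; exact: measurableX.
rewrite /leb_succ /pushforward -comp_preimage.
rewrite (_ : _ \o _ = id) ?preimage_id; last first.
  by apply/funext => x /=; rewrite tconsK.
by rewrite product_measure1E// lte_mul_pinfty// ge0_fin_numE.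
Qed.

HB.instance Definition _ :=
  Measure_isSigmaFinite.Build _ _ _ leb_succ leb_succ_sigma_finite.

End succ.

(* Lebesgue measure on the Borel sets of R^n. *)
Fixpoint leb n : {sigma_finite_measure set (n.-tuple RT) -> \bar R} :=
  match n with
  | 0 => dirac [tuple]
  | n'.+1 => leb_succ (leb n')
  end.

End borel_lebesgue.

(* R^n with its Lebesgue (not only Borel) measurable sets: those measurable in
   the sense of Caratheodory for the outer measure induced by [leb n]. *)
Definition rspace (R : realType) (n : nat) :=
  caratheodory_type ((@leb R n)^*)%mu.

(* The complete n-dimensional Lebesgue measure. *)
Definition lebn {R : realType} (n : nat) : {measure set (rspace R n) -> \bar R} :=
  @completed_measure_extension _ _ _ (@leb R n).

(* The real line with its Lebesgue measurable sets, the carrier of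
   [completed_lebesgue_measure]. *)
Definition lreal (R : realType) :=
  caratheodory_type ((@wlength R idfun)^*)%mu.

Section uniform_cube.
Context {R : realType}.
Local Notation RT := (measurableTypeR R).

Definition cube n : set (n.-tuple R) :=
  [set x | forall i, 0 <= tnth x i <= 1].

Lemma cubeS n :
  @cube n.+1 = (@tuncons R n) @^-1` (`[0, 1]%classic `*` @cube n).
Proof.
apply/seteqP; split => [x cx|x [/= x0 cx] i].
  split => /=; first by have := cx ord0; rewrite in_itv.
  by move=> i; have := cx (lift ord0 i); rewrite {1 2}(tuple_eta x) tnthS.
have [j ->|->] := unliftP ord0 i; last by move: x0; rewrite in_itv.
by rewrite (tuple_eta x) tnthS; exact: cx.
Qed.

Lemma measurable_cube_borel n : measurable (@cube n : set (n.-tuple RT)).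
Proof.
elim: n => [|n ih].
  by rewrite (_ : @cube 0 = setT)//; apply/seteqP; split => // x _ [].
rewrite cubeS -[X in measurable X]setTI.
by apply: measurable_tuncons => //; exact: measurableX.
Qed.

Lemma measurable_cube n : measurable (@cube n : set (rspace R n)).
Proof.
by apply: caratheodory_measurable_mu_ext; exact: measurable_cube_borel.
Qed.

Lemma leb_cube n : leb n (@cube n) = 1%E.
Proof.
elim: n => [|n ih].
  by rewrite /= diracE mem_set// => -[].
rewrite /= /leb_succ /pushforward cubeS -comp_preimage.
rewrite (_ : _ \o _ = id) ?preimage_id; last first.
  by apply/funext => x /=; rewrite tconsK.
rewrite product_measure1E//; last exact: measurable_cube_borel.
rewrite ih mule1; have := lebesgue_measure_itv (`[0, 1] : interval R).
by rewrite /= lte_fin ltr01 oppr0 adde0.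
Qed.

Definition unif_cube n : set (rspace R n) -> \bar R :=
  mrestr (lebn n) (@measurable_cube n).

HB.instance Definition _ n := Measure.on (@unif_cube n).

Let unif_cube_setT n : @unif_cube n setT = 1%E.
Proof.
rewrite /unif_cube /mrestr setTI -(@leb_cube n).
by apply: measurable_mu_extE; exact: measurable_cube_borel.
Qed.

HB.instance Definition _ n :=
  Measure_isProbability.Build _ _ _ (@unif_cube n) (@unif_cube_setT n).

End uniform_cube.

Section weighted_space.
Context {R : realType} {d : nat}.
Variables (X : 'I_d -> set R) (lam : 'I_d -> R -> R).

Definition box : set (d.-tuple R) := [set x | forall i, X i (tnth x i)].

Definition weight (x : d.-tuple R) : R := \prod_(i < d) lam i (tnth x i).

Definition weight_mass : \bar R :=
  (\prod_(i < d) \int[completed_lebesgue_measure]_(t in X i) (lam i t)%:E)%E.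

(* Integral of [f] over X_1 x ... x X_d against the measure lambda(x) dx. *)
Definition wint (f : d.-tuple R -> R) : \bar R :=
  (\int[lebn d]_(x in box) (f x * weight x)%:E)%E.

Definition Lnormw (p : R) (f : d.-tuple R -> R) : \bar R :=
  (wint (fun x => `|f x|%R `^ p)%R `^ p^-1)%E.

Definition in_Lpw (p : R) (f : d.-tuple R -> R) : Prop :=
  measurable_fun (box : set (rspace R d)) (f : rspace R d -> R) /\
  (Lnormw p f < +oo)%E.

End weighted_space.

Section densities.
Context {R : realType} {n : nat}.
Implicit Types nu : {measure set (rspace R n) -> \bar R}.

Definition is_density nu (p : rspace R n -> R) : Prop :=
  [/\ measurable_fun setT p, forall x, 0 <= p x &
      forall A : set (rspace R n), measurable A ->
        nu A = (\int[lebn n]_(x in A) (p x)%:E)%E].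

(* Lebesgue density, well defined up to a null set when there is one. *)
Definition density nu : rspace R n -> R :=
  xget (cst 0) [set p | is_density nu p].

(* The divergence is infinite without absolute continuity. Points where the
   density of [nu'] vanishes contribute 0, since [x / 0 = 0]. *)
Definition chi2_div nu nu' : \bar R :=
  if `[< nu `<< nu' >] then
    (\int[lebn n]_x ((density nu x / density nu' x) ^+ 2 * density nu' x)%:E
      - 1)%E
  else +oo%E.

End densities.

(* Dependent product G_1(x_1) ... G_k(x_k), with G_(j+1) stored as [G j]. *)
Fixpoint tt_prod {R : realType} (r : nat -> nat)
    (G : forall k, R -> 'M[R]_(r k, r k.+1)) (x : seq R) (k : nat) :
    'M[R]_(r 0%N, r k) :=
  match k with
  | 0 => 1%:M
  | k'.+1 => tt_prod G x k' *m G k' (nth 0 x k')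
  end.

Definition tensor_train {R : realType} {d : nat} (X : 'I_d -> set R)
    (g : d.-tuple R -> R) : Prop :=
  exists (r : nat -> nat) (G : forall k, R -> 'M[R]_(r k, r k.+1)),
    [/\ r 0%N = 1%N, r d = 1%N &
        forall x : d.-tuple R, box X x ->
          forall i j, tt_prod G x d i j = g x].

Section rosenblatt.
Context {R : realType}.

(* F_1(x_1), F_2(x_2 | x_1), ... for the probability density proportional to
   [h]: the first component is the distribution function of the first marginal
   of [h], and the remaining ones are obtained from the section [h (x_1, .)],
   which is the unnormalised conditional density of (x_2, ..., x_n) given
   x_1. Thus the k-th component is
     F_k(x_k | x_<k) = \int_(y_1 <= x_k) h(x_<k, y) dy / \int h(x_<k, y) dy,
   with y ranging over R^(n - k + 1). Whenever one of these integrals is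
   infinite, or the denominator is 0, the component has an arbitrary value;
   this happens only for x in a null set of the law with density [h]. *)
Fixpoint rosenblatt n : (n.-tuple R -> R) -> n.-tuple R -> n.-tuple R :=
  match n with
  | 0 => fun _ _ => [tuple]
  | n'.+1 => fun h x =>
      let below := [set y : n'.+1.-tuple R | thead y <= thead x] in
      let F1 := fine (\int[lebn n'.+1]_(y in below) (h y)%:E) /
                fine (\int[lebn n'.+1]_y (h y)%:E) in
      let section (t : n'.-tuple R) := h [tuple of thead x :: t] in
      [tuple of F1 :: rosenblatt section [tuple of behead x]]
  end.

(* The distribution functions need not be strictly increasing on all of R nor
   attain 0 and 1, so [T] is asked to be a right inverse, with values in [X],
   at almost every u of the cube; values outside the cube are irrelevant. *)
Definition inverse_rosenblatt n (X : set (n.-tuple R)) (h : n.-tuple R -> R)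
    (T : n.-tuple R -> n.-tuple R) : Prop :=
  {ae @unif_cube R n, forall u, X (T u) /\ rosenblatt h (T u) = u}.

End rosenblatt.

Section transport.
Context {R : realType} {d : nat}.
Variables (X : 'I_d -> set R) (lam : 'I_d -> R -> R).

Definition target_mass (target : d.-tuple R -> R) : R :=
  fine (wint X lam target).

Definition target_density (target : d.-tuple R -> R) : d.-tuple R -> R :=
  (fun x => (target_mass target)^-1 * (target x * weight lam x)) \_ (box X).

Variables (g : d.-tuple R -> R) (gamma : R).

Definition pihat (x : d.-tuple R) : R := gamma + g x ^+ 2.

(* Total mass of [pihat], i.e. the normalising constant of the approximation. *)
Definition approx_mass : R :=
  gamma * fine (weight_mass X lam) + fine (wint X lam (fun x => g x ^+ 2)).

Definition approx_density : d.-tuple R -> R :=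
  (fun x => approx_mass^-1 * (pihat x * weight lam x)) \_ (box X).

End transport.

(* Main.v *)
(** Let [q] be the normalised approximation, [p] the target density and
[rho = pi / pihat].

Law of the transport. A measurable right inverse [T] of the Rosenblatt map of
[q] pushes the uniform law to [q dx]. One coordinate is treated at a time: given
the coordinates [T_1, .., T_k], the equation [F_(k+1)(T_(k+1)) = u_(k+1)] and
monotonicity of the conditional distribution function give the law of
[T_(k+1)], and independence of [u_(k+2), .., u_d] is inherited. Lebesgue
measurable data are first replaced by Borel versions off null sets, so that
Tonelli's theorem applies.

Divergence. As [p / q = (zhat / z) rho], the divergence equals
[(zhat / z) \int rho (p - q)]. Writing [p - q] as
[(sqrt p - sqrt q) (sqrt p + sqrt q)], Cauchy-Schwarz bounds it by
[(zhat / z) ||sqrt p - sqrt q|| (nu(rho^2)^(1/2) + That(rho^2)^(1/2))], and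
[||sqrt p - sqrt q|| <= 2 sqrt 2 eps / sqrt z] because
[(sqrt pi - sqrt (gamma + g^2))^2 <= gamma + (g - sqrt pi)^2]. *)

Require Import Defs.
From HB Require Import structures.
From mathcomp Require Import all_boot all_order all_algebra.
From mathcomp Require Import all_classical all_reals all_analysis.
From mathcomp Require Import measurable_realfun lra ring.

Import Order.TTheory GRing.Theory Num.Theory.
Import numFieldNormedType.Exports.

Local Open Scope classical_set_scope.
Local Open Scope ring_scope.

(** * Borel versions and completions *)

(** The Rosenblatt map integrates sections of [h] itself, and a section of a Lebesgue measurable
    function may fail to be measurable. Almost everywhere this is harmless: the null set [N] off
    which [h] has a Borel version [h0] has null sections over almost every prefix, and there the
    completed integrals of [h] are the Borel integrals of [h0]. So the induction on the dimension
    carries [N] along with [h] and [h0]. The underlying probability space stays fixed while the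
    space [P] of transported prefixes gains one coordinate at each stage; the statement that
    propagates is the joint law of the prefix and the uniform coordinates not yet used.

    In the constant, the bound on [gamma] makes the squared distance of the unnormalised roots at
    most [2 eps^2]. Normalising costs a further factor 4 in the square, and dividing by [z] gives
    [8 eps^2 / z], the square of [2 sqrt 2 eps / sqrt z]. Boundedness of [pi / pihat] supplies
    absolute continuity and finiteness of the integrals that contain the ratio. *)

Lemma measurable_funV {R : realType} {d} {T : measurableType d} (D : set T)
    (f : T -> R) : measurable_fun D f -> measurable_fun D (fun x => (f x)^-1).
Proof.
(* Inversion is discontinuous at 0, so it is routed through the power [-1], which is measurable and
   agrees with the inverse on nonnegative reals. Squaring makes the argument nonnegative, and at a
   zero of [f] both sides are 0. *)
move=> mf; apply: (eq_measurable_fun (fun x => f x * (f x ^+ 2) `^ (-1))).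
  move=> x _; rewrite powR_inv1 ?sqr_ge0//.
  have [->|fx0] := eqVneq (f x) 0; first by rewrite invr0 mul0r.
  by rewrite expr2 invfM mulrA divff// mul1r.
apply: measurable_funM => //.
by apply: (measurableT_comp (measurable_powR (-1))); exact: measurable_funX.
Qed.

Section completion.
Context {d} {T : measurableType d} {R : realType}.
Local Open Scope ereal_scope.

(** A countable cover within [1/(n+1)] of the infimum defining the outer measure is united into one
    measurable set; the intersection over [n] is the hull. When the outer measure is infinite the
    whole space serves. *)
Lemma mu_ext_hull (mu : {measure set T -> \bar R}) (A : set T) :
  exists B, [/\ measurable B, A `<=` B & mu B = (mu^*)%mu A].
Proof.
have [Aoo|Aoo] := eqVneq ((mu^*)%mu A) +oo.
  exists setT; split => //; apply/eqP; rewrite Aoo -leye_eq -Aoo.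
  by rewrite -(measurable_mu_extE mu measurableT) le_mu_ext.
have Afin : (mu^*)%mu A \is a fin_num by rewrite ge0_fin_numE ?mu_ext_ge0// ltey.
have cov n : exists B, [/\ measurable B, A `<=` B &
    mu B <= (mu^*)%mu A + n.+1%:R^-1%:E].
  have [_ [F [mF AF] <-] /ltW Fle] :=
    lb_ereal_inf_adherent (divr_gt0 (@ltr01 R) (ltr0Sn _ n)) Afin.
  exists (\bigcup_k F k); split => //; first exact: bigcupT_measurable.
  rewrite div1r in Fle; apply: le_trans Fle.
  by apply: generalized_Boole_inequality => //; exact: bigcupT_measurable.
have [B /all_and3[mB AB Ble]] := choice cov.
have mBB : measurable (\bigcap_n B n) by exact: bigcapT_measurable.
have ABB : A `<=` \bigcap_n B n by move=> x Ax n _; exact: AB.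
exists (\bigcap_n B n); split => //; apply/eqP; rewrite eq_le; apply/andP; split.
  apply/lee_addgt0Pr => e e0.
  have [n ne] : exists n, (n.+1%:R^-1 < e :> R)%R.
    have [n _ /(_ n (leqnn n)) /= H] := near_infty_natSinv_lt (PosNum e0).
    by exists n.
  apply: le_trans (leeD2l _ (ltW _ : n.+1%:R^-1%:E <= e%:E)); last first.
    by rewrite lte_fin.
  by apply: le_trans (Ble n); apply: le_measure; rewrite ?inE//; exact: bigcap_inf.
by rewrite -(measurable_mu_extE mu mBB) le_mu_ext.
Qed.

Lemma mu_ext_eq0 (mu : {measure set T -> \bar R}) (A : set T) :
  (mu^*)%mu A = 0 -> exists N, [/\ measurable N, mu N = 0 & A `<=` N].
Proof.
by move=> A0; have [N [mN AN NA]] := mu_ext_hull mu A; exists N; rewrite NA A0.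
Qed.

(** A hull exceeds a Caratheodory set by a null set, but the subtraction that shows it needs finite
    measure; hence hulls are taken of the pieces [A & F k]. Off the union of the null excesses, [A]
    is the union of the hulls. *)
Lemma caratheodory_borel (mu : {measure set T -> \bar R}) (A : set T) :
  sigma_finite setT mu -> (mu^*)%mu.-cara.-measurable A ->
  exists N, [/\ measurable N, mu N = 0 & measurable (A `\` N)].
Proof.
move=> [F TF /all_and2[mF Foo]] cA.
have loc k : exists BN : set T * set T, [/\ measurable BN.1, measurable BN.2,
    mu BN.2 = 0, A `&` F k `<=` BN.1 & BN.1 `\` (A `&` F k) `<=` BN.2].
  have [B [mB AB BE]] := mu_ext_hull mu (A `&` F k).
  pose C : {measure set (caratheodory_type (mu^*)%mu) -> \bar R} :=
    @completed_measure_extension _ _ _ mu.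
  have cAF : measurable (A `&` F k : set (caratheodory_type (mu^*)%mu)).
    apply: measurableI => //; exact: caratheodory_measurable_mu_ext.
  have cB : measurable (B : set (caratheodory_type (mu^*)%mu)).
    exact: caratheodory_measurable_mu_ext.
  have AFoo : (mu^*)%mu (A `&` F k) < +oo.
    apply: le_lt_trans (Foo k); rewrite -(measurable_mu_extE mu (mF k)).
    exact: le_mu_ext.
  have : (mu^*)%mu (B `\` (A `&` F k)) = 0.
    have -> : (mu^*)%mu (B `\` (A `&` F k)) = C (B `\` (A `&` F k)) by [].
    have CB : C B = (mu^*)%mu (A `&` F k) by rewrite -BE; exact: measurable_mu_extE.
    have Coo : C B < +oo by rewrite CB.
    apply: (etrans (measureD cB cAF Coo : C _ = _)); rewrite setIidr//.
    transitivity ((mu^*)%mu (A `&` F k) - (mu^*)%mu (A `&` F k)).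
      by congr (_ - _); exact: CB.
    by rewrite subee// ge0_fin_numE// mu_ext_ge0.
  by move=> /mu_ext_eq0[N [mN N0 BN]]; exists (B, N).
have [BN /all_and5[mB mN N0 AB BA]] := choice loc.
have mNN : measurable (\bigcup_k (BN k).2) by exact: bigcupT_measurable.
exists (\bigcup_k (BN k).2); split => //.
  apply/eqP; rewrite -measure_le0.
  apply: le_trans (generalized_Boole_inequality mu _ mNN) _ => //.
  by rewrite eseries0// => i _ _; rewrite N0.
rewrite (_ : _ `\` _ = (\bigcup_k (BN k).1) `\` (\bigcup_k (BN k).2)).
  by apply: measurableD => //; exact: bigcupT_measurable.
apply/seteqP; split => [x [Ax nx]|x [[k _ Bx] nx]]; split => //.
  have [k _ Fx] : (\bigcup_k F k) x by rewrite -TF.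
  by exists k => //; exact: AB.
apply: contrapT => nAx; apply: nx; exists k => //; apply: BA; split => //.
by move=> -[].
Qed.

(** Rational thresholds are enough: [{r < f}] is the union of [{q < f}] over rationals [q >= r].
    Countably many null sets, indexed through [pickle], are then discarded at once. *)
Lemma borel_version (mu : {measure set T -> \bar R}) (f : T -> R) :
  (forall r : R, exists N, [/\ measurable N, mu N = 0 &
     measurable ([set x | (r < f x)%R] `\` N)]) ->
  exists N, [/\ measurable N, mu N = 0 & measurable_fun (~` N) f].
Proof.
move=> H; have /choice[N /all_and3[mN N0 mfN]] : forall k : nat,
    exists N, [/\ measurable N, mu N = 0 &
      if @unpickle rat k is Some q then
      measurable ([set x | (ratr q < f x)%R] `\` N) else True].
  move=> k; case: (unpickle k) => [q|]; first exact: H.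
  by exists set0; rewrite measure0.
have mNN : measurable (\bigcup_k N k) by exact: bigcupT_measurable.
exists (\bigcup_k N k); split => //.
  apply/eqP; rewrite -measure_le0.
  apply: le_trans (generalized_Boole_inequality mu _ mNN) _ => //.
  by rewrite eseries0// => i _ _; rewrite N0.
move=> mD; apply: (measurability _ (measurable_realfun.RGenOInfty.measurableE R)) => //.
move=> _ [_ [r ->] <-].
rewrite (_ : _ `&` _ = \bigcup_(q in [set q : rat | (r <= ratr q)%R])
   (([set x | (ratr q < f x)%R] `\` N (pickle q)) `\` \bigcup_k N k)).
  rewrite bigcup_mkcond; apply: bigcupT_measurable_rat => q; case: ifPn => // _.
  apply: measurableD => //.
  by have := mfN (pickle q); rewrite pickleK.
apply/seteqP; split => [x /= [nx]|x [q /= rq [[qx _] nx]]].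
  rewrite in_itv/= andbT => rx; have [q /itvP q_] := rat_in_itvoo rx.
  exists q => /=; first by rewrite q_.
  split => //; split => //; first by rewrite q_.
  by move=> Nx; apply: nx; exists (pickle q).
by split => //; rewrite in_itv/= andbT (le_lt_trans rq).
Qed.

Context {d'} {T' : measurableType d'} (i : T' -> T).
Hypothesis mi : measurable_fun setT i.
Variables (mu : {measure set T -> \bar R}) (mu' : {measure set T' -> \bar R}).
Hypothesis mu'E : forall A, measurable A -> mu' (i @^-1` A) = mu A.
Hypothesis cmu' : measure_is_complete mu'.

(** In the applications [i] is the identity from a completed space to its Borel space. Then [A]
    differs from a Borel set only inside a null set, where completeness makes every subset
    measurable. *)
Lemma completion_measurable_set (A : set T') (B N : set T) :
  measurable B -> measurable N -> mu N = 0 ->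
  (forall x, ~ N (i x) -> A x <-> B (i x)) -> measurable A.
Proof.
move=> mB mN N0 AB.
have pre C : measurable C -> measurable (i @^-1` C).
  by move=> mC; rewrite -[X in measurable X]setTI; exact: mi.
rewrite (_ : A = (i @^-1` B `\` i @^-1` N) `|` (A `&` i @^-1` N)).
  apply: measurableU; first by apply: measurableD; exact: pre.
  apply: cmu'; exists (i @^-1` N); split => //; first exact: pre.
  exact: etrans (mu'E _ mN) N0.
apply/seteqP; split => [x Ax|x [[Bx nx]|[]//]]; last exact/(AB _ nx).
have [Nx|Nx] := pselect (N (i x)); first by right.
by left; split => //; exact/(AB _ Nx).
Qed.

Lemma completion_ae_eq (f : T' -> \bar R) (g : T -> \bar R) (N : set T) :
  measurable N -> mu N = 0 -> (forall x, ~ N (i x) -> f x = g (i x)) ->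
  ae_eq mu' setT f (g \o i).
Proof.
move=> mN N0 fg; exists (i @^-1` N); split.
- by rewrite -[X in measurable X]setTI; exact: mi.
- exact: etrans (mu'E _ mN) N0.
- move=> x /= nfg; apply: contrapT => nN; apply: nfg => _; exact: fg.
Qed.

Lemma completion_measurable_fun (f : T' -> \bar R) (g : T -> \bar R) (N : set T) :
  measurable_fun setT (g : T -> \bar R) ->
  measurable N -> mu N = 0 -> (forall x, ~ N (i x) -> f x = g (i x)) ->
  measurable_fun setT f.
Proof.
move=> mg mN N0 fg; apply: (ae_measurable_fun cmu' (f := g \o i)).
  by apply: filterS (completion_ae_eq f g N mN N0 fg) => x H /H.
exact: measurableT_comp.
Qed.

Lemma completion_integral (f : T' -> \bar R) (g : T -> \bar R) (N : set T) :
  measurable_fun setT g -> (forall x, 0 <= g x) -> (forall x, 0 <= f x) ->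
  measurable N -> mu N = 0 -> (forall x, ~ N (i x) -> f x = g (i x)) ->
  \int[mu']_x f x = \int[mu]_x g x.
Proof.
move=> mg g0 f0 mN N0 fg.
have mf := completion_measurable_fun f g N mg mN N0 fg.
have mgi : measurable_fun setT (g \o i) by exact: measurableT_comp.
have ae := completion_ae_eq f g N mN N0 fg.
rewrite (ge0_ae_eq_integral measurableT mf mgi (fun x _ => f0 x) (fun x _ => g0 (i x)) ae).
rewrite -[in LHS](preimage_setT i) -(ge0_integral_pushforward mi)//.
by apply: eq_measure_integral => A mA _; exact: mu'E.
Qed.

End completion.

(** * Product measures and densities *)

Section weighted_measure.
Context {d} {T : measurableType d} {R : realType}.
Local Open Scope ereal_scope.

(** The two proofs are carried as arguments so that the measure structure below can be attached to
    the term. *)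
Definition weighted (mu : {measure set T -> \bar R}) (f : T -> \bar R)
    (mf : measurable_fun setT f) (f0 : forall x, 0 <= f x) : set T -> \bar R :=
  fun A => \int[mu]_(x in A) f x.

Section instance.
Variables (mu : {measure set T -> \bar R}) (f : T -> \bar R).
Hypotheses (mf : measurable_fun setT f) (f0 : forall x, 0 <= f x).

Let weighted0 : weighted mu f mf f0 set0 = 0.
Proof. by rewrite /weighted integral_set0. Qed.

Let weighted_ge0 A : 0 <= weighted mu f mf f0 A.
Proof. by apply: integral_ge0. Qed.

Let weighted_semi_sigma_additive : semi_sigma_additive (weighted mu f mf f0).
Proof. exact: semi_sigma_additive_nng_induced. Qed.

HB.instance Definition _ := isMeasure.Build _ _ _ (weighted mu f mf f0)
  weighted0 weighted_ge0 weighted_semi_sigma_additive.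

End instance.

Import HBNNSimple.

(** Monotone convergence on both sides reduces the formula to simple functions, and linearity to
    indicators, where it is the hypothesis on [nu]. *)
Lemma integral_weighted (mu nu : {measure set T -> \bar R}) (p : T -> \bar R) :
  measurable_fun setT p -> (forall x, 0 <= p x) ->
  (forall A, measurable A -> nu A = \int[mu]_(x in A) p x) ->
  forall f : T -> \bar R, measurable_fun setT f -> (forall x, 0 <= f x) ->
  \int[nu]_x f x = \int[mu]_x (f x * p x).
Proof.
move=> mp p0 nuE f mf f0.
pose f_ := nnsfun_approx measurableT mf.
have cf x : (f_ n x)%:E @[n --> \oo] --> f x by exact: cvg_nnsfun_approx.
have f_nd x : {homo (fun n => (f_ n x)%:E) : n m / (n <= m)%N >-> n <= m}.
  by move=> n m nm; rewrite lee_fin; exact/lefP/nd_nnsfun_approx.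
have mf_ n : measurable_fun setT (fun x => (f_ n x)%:E).
  by apply/measurable_EFinP/measurable_funP.
transitivity (limn (fun n => \int[nu]_x (f_ n x)%:E)).
  rewrite -monotone_convergence//.
  - by apply: eq_integral => x _; apply/esym/cvg_lim => //; exact: cf.
  - by move=> n x _; rewrite lee_fin.
transitivity (limn (fun n => \int[mu]_x ((f_ n x)%:E * p x))); last first.
  rewrite -monotone_convergence//.
  - apply: eq_integral => x _; apply/cvg_lim => //.
    (* The limit of the product could be an indeterminate [0 * +oo], so zeros of [p] and of [f] are
       treated apart. At a zero of [f] the approximations vanish too, since they increase to [f]. *)
    have [px0|px0] := eqVneq (p x) 0.
      by rewrite px0 mule0; under eq_fun do rewrite mule0; exact: cvg_cst.
    have [fx0|fx0] := eqVneq (f x) 0.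
      rewrite fx0 mul0e (_ : (fun n => _) = cst 0); first exact: cvg_cst.
      apply/funext => n; rewrite (_ : (f_ n x)%:E = 0) ?mul0e//.
      apply/eqP; rewrite eq_le; apply/andP; split; last by rewrite lee_fin.
      rewrite -[leRHS]fx0 -(cvg_lim _ (cf x))//; apply: lime_ge.
        by apply/cvg_ex; exists (f x); exact: cf.
      by exists n => // m /= nm; exact: f_nd.
    apply: cvgeM; [|exact: cf|exact: cvg_cst].
    by rewrite mule_defE (negbTE px0) (negbTE fx0).
  - by move=> n; apply: emeasurable_funM.
  - by move=> n x _; rewrite mule_ge0// lee_fin.
  - by move=> x _ n m nm; rewrite lee_wpmul2r// f_nd.
congr (limn _); apply/funext => n.
rewrite integralT_nnsfun sintegralE.
under eq_integral.
  move=> x _; rewrite fimfunE -fsumEFin// ge0_mule_fsuml; last first.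
    by move=> r; rewrite nnfun_muleindic_ge0.
  over.
rewrite ge0_integral_fsum//; last 2 first.
- by move=> r; apply: emeasurable_funM => //; exact/measurable_EFinP/measurable_funM.
- by move=> r x _; rewrite mule_ge0// nnfun_muleindic_ge0.
apply: eq_fsbigr => r rr; rewrite nuE//.
have r0 : (0 <= r)%R by case/set_mem: rr => x _ <-.
under [RHS]eq_integral do rewrite EFinM -muleA.
rewrite ge0_integralZl//.
- congr (_ * _); rewrite integral_mkcond; apply: eq_integral => x _.
  by rewrite /patch indicE /=; case: ifPn => _; rewrite ?mul1e ?mul0e.
- by apply: emeasurable_funM => //; exact/measurable_EFinP.
- by move=> x _; rewrite mule_ge0// lee_fin.
Qed.

End weighted_measure.

Section tuple_integral.
Context {R : realType}.
Local Notation RT := (measurableTypeR R).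
Local Open Scope ereal_scope.

Lemma leb_integralS n (F : n.+1.-tuple RT -> \bar R) :
  measurable_fun setT F -> (forall x, 0 <= F x) ->
  \int[leb n.+1]_x F x =
  \int[lebesgue_measure]_t \int[leb n]_y F (tcons (t, y)).
Proof.
move=> mF F0.
transitivity (\int[(lebesgue_measure \x leb n)]_q F (tcons q)).
  rewrite -[in RHS](preimage_setT (@tcons R n)).
  by rewrite -(ge0_integral_pushforward (@measurable_tcons R n)).
rewrite (fubini_tonelli1 (F \o @tcons R n))//.
  by apply: measurableT_comp => //; exact: measurable_tcons.
by move=> q; exact: F0.
Qed.

Lemma leb_tcons n (A : set RT) (B : set (n.-tuple RT)) :
  measurable A -> measurable B ->
  leb n.+1 (@tuncons R n @^-1` (A `*` B)) = lebesgue_measure A * leb n B.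
Proof.
move=> mA mB; rewrite /= /leb_succ /pushforward -comp_preimage.
rewrite (_ : _ \o _ = id) ?preimage_id ?product_measure1E//.
by apply/funext => x /=; rewrite tconsK.
Qed.

(** Moves the first tuple coordinate into the parameter space: the change of variables behind the
    induction on the dimension. *)
Lemma leb_integralA {d} {P : measurableType d}
    (p : {sigma_finite_measure set P -> \bar R}) n
    (F : P * n.+1.-tuple RT -> \bar R) :
  measurable_fun setT F -> (forall x, 0 <= F x) ->
  \int[p]_q \int[leb n.+1]_y F (q, y) =
  \int[p \x lebesgue_measure]_q \int[leb n]_y F (q.1, tcons (q.2, y)).
Proof.
move=> mF F0.
have mF' : measurable_fun setT
    (fun r : (P * RT) * n.-tuple RT => F (r.1.1, tcons (r.1.2, r.2))).
  apply: measurableT_comp => //; apply: measurable_fun_pair.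
    exact: measurableT_comp.
  apply: measurableT_comp; first exact: measurable_tcons.
  by apply: measurable_fun_pair => //; exact: measurableT_comp.
rewrite fubini_tonelli1//.
- apply: eq_integral => q _; rewrite leb_integralS//.
  exact: measurableT_comp.
- exact: (measurable_fun_fubini_tonelli_F
    (fun r : (P * RT) * n.-tuple RT => F (r.1.1, tcons (r.1.2, r.2)))).
- by move=> q; apply: integral_ge0.
Qed.

End tuple_integral.

Section sigma_finite_product.
Context {d1 d2} {T1 : measurableType d1} {T2 : measurableType d2} {R : realType}.
Variables (m1 : {sigma_finite_measure set T1 -> \bar R})
  (m2 : {sigma_finite_measure set T2 -> \bar R}).
Local Open Scope ereal_scope.

(* The library's sigma-finite instance on [m1 \x m2] is shadowed by the later
   one for subprobabilities, hence this alias. *)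
Definition sf_product : set (T1 * T2) -> \bar R := m1 \x m2.

HB.instance Definition _ := Measure.on sf_product.

Let sf_product_sigma_finite : sigma_finite setT sf_product.
Proof.
have /sigma_finiteP[F [TF ndF Foo]] := sigma_finiteT m1.
have /sigma_finiteP[G [TG ndG Goo]] := sigma_finiteT m2.
exists (fun k => F k `*` G k).
  apply/esym/seteqP; split => // -[x y] _.
  have [i _ Fi] : (\bigcup_i F i) x by rewrite -TF.
  have [j _ Gj] : (\bigcup_j G j) y by rewrite -TG.
  exists (maxn i j) => //; split => /=.
    by move: Fi; apply/subsetPset/ndF/leq_maxl.
  by move: Gj; apply/subsetPset/ndG/leq_maxr.
move=> k; have [mFk Fk] := Foo k; have [mGk Gk] := Goo k.
split; first exact: measurableX.
by rewrite /sf_product product_measure1E// lte_mul_pinfty// ge0_fin_numE.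
Qed.

HB.instance Definition _ :=
  Measure_isSigmaFinite.Build _ _ _ sf_product sf_product_sigma_finite.

End sigma_finite_product.

Section product_uniqueness.
Context {d1 d2} {T1 : measurableType d1} {T2 : measurableType d2} {R : realType}.
Local Open Scope ereal_scope.

Lemma measure_rectangle_unique (m m' : {measure set (T1 * T2) -> \bar R}) :
  m setT < +oo ->
  (forall A B, measurable A -> measurable B -> m (A `*` B) = m' (A `*` B)) ->
  forall X, measurable X -> m X = m' X.
Proof.
move=> moo mm' X mX.
pose C := [set A `*` B | A in @measurable _ T1 & B in @measurable _ T2].
apply: (measure_unique C (fun=> setT)) => //.
- exact: measurable_prod_measurableType.
- move=> _ _ [A mA [B mB <-]] [A' mA' [B' mB' <-]].
  rewrite -setXI; exists (A `&` A'); first exact: measurableI.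
  by exists (B `&` B') => //; exact: measurableI.
- by move=> _; exists setT => //; exists setT => //; rewrite setXTT.
- by rewrite bigcup_const//; exists 0%N.
- by move=> _ [A mA [B mB <-]]; exact: mm'.
Qed.

Lemma measure_rectangle_product (m : {measure set (T1 * T2) -> \bar R})
    (m1 : {measure set T1 -> \bar R}) (m2 : {measure set T2 -> \bar R}) :
  m setT < +oo -> m2 setT < +oo ->
  (forall A B, measurable A -> measurable B -> m (A `*` B) = m1 A * m2 B) ->
  forall X, measurable X -> m X = \int[m1]_x m2 (xsection X x).
Proof.
move=> moo m2oo mm12 X mX.
(* Restricting to the whole space changes no value; it presents [m2] as a finite measure, to serve
   as a factor of the product. *)
pose k2 := mfrestr measurableT m2oo.
have k2E B : k2 B = m2 B by rewrite /k2 /mfrestr /mrestr setIT.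
rewrite (measure_rectangle_unique m (m1 \x k2)%E)//.
  by apply: eq_integral => x _; exact: k2E.
move=> A B mA mB; rewrite mm12//.
by apply: etrans (esym (product_measure1E _ _ mA mB)); rewrite -k2E.
Qed.

End product_uniqueness.

Section ray_uniqueness.
Context {d} {P : measurableType d} {R : realType}.
Local Notation RT := (measurableTypeR R).
Local Open Scope ereal_scope.

(** Fixing the side [B] leaves two measures on the line, compared on the pi-system of open rays;
    agreement on all rectangles follows. Open rays are used because the events [{Y < a}] are the
    ones that get sandwiched later. *)
Lemma measure_ray_unique (m m' : {measure set (P * RT) -> \bar R}) :
  m setT < +oo ->
  (forall B a, measurable B ->
     m (B `*` `]-oo, a[%classic) = m' (B `*` `]-oo, a[%classic)) ->
  forall X, measurable X -> m X = m' X.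
Proof.
move=> moo mm'; apply: measure_rectangle_unique => // B I mB mI.
have mBT : measurable (B `*` [set: RT]) by exact: measurableX.
have msnd := @measurable_snd _ _ P RT.
have kE (J : set RT) : (@snd P RT @^-1` J) `&` B `*` setT = B `*` J.
  by apply/seteqP; split => [[p t] /= [? []]|[p t] /= []].
pose K := measure_function_pushforward__canonical__measure_function_Measure
  (mrestr m mBT) msnd.
pose K' := measure_function_pushforward__canonical__measure_function_Measure
  (mrestr m' mBT) msnd.
have KE J : K J = m (B `*` J) by rewrite /K /= /pushforward /mrestr kE.
have K'E J : K' J = m' (B `*` J) by rewrite /K' /= /pushforward /mrestr kE.
rewrite -KE -K'E.
pose G : set (set RT) := [set A | exists x, A = `]-oo, x[%classic].
have mG : @measurable _ RT = <<s G >> by exact: measurable_realfun.RGenInftyO.measurableE.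
have GI : setI_closed G.
  move=> _ _ [x ->] [y ->]; exists (Num.min x y).
  by apply/seteqP; split => z /=; rewrite !in_itv/= lt_min => /andP.
have Gg (n : nat) : G `]-oo, n%:R[%classic by exists n%:R.
have gT : \bigcup_n `]-oo, (n%:R : R)[%classic = [set: RT].
  apply/seteqP; split => // x _; exists (Num.truncn x).+1 => //=.
  by rewrite in_itv/= truncnS_gt.
apply: (measure_unique G _ mG GI Gg gT) => //.
- by move=> _ [a ->]; rewrite KE K'E mm'.
- move=> n; rewrite KE; apply: le_lt_trans moo.
  by apply: le_measure; rewrite ?inE//; exact: measurableX.
Qed.

End ray_uniqueness.

Section lebn_facts.
Context {R : realType}.
Local Notation RT := (measurableTypeR R).
Local Open Scope ereal_scope.

Lemma lebnE n (A : set (n.-tuple RT)) : measurable A -> lebn n A = leb n A.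
Proof. by move=> mA; exact: measurable_mu_extE. Qed.

Lemma measurable_rspace_id n :
  measurable_fun setT (fun x : rspace R n => x : n.-tuple RT).
Proof.
by move=> _ A mA; rewrite setTI; exact: caratheodory_measurable_mu_ext.
Qed.

Lemma lebn_complete n : measure_is_complete (@lebn R n).
Proof. exact: measure_is_complete_caratheodory. Qed.

(** Measurability of [f] comes from completeness and the agreement with [g]. This is what makes the
    lemma applicable to the sections of [h]. *)
Lemma lebn_integral n (D N : set (n.-tuple RT)) (f : n.-tuple RT -> R)
    (g : n.-tuple RT -> \bar R) :
  measurable D -> measurable_fun setT g ->
  (forall x, 0 <= g x) -> (forall x, (0 <= f x)%R) ->
  measurable N -> leb n N = 0 -> (forall x, ~ N x -> (f x)%:E = g x) ->
  \int[lebn n]_(x in D) (f x)%:E = \int[leb n]_(x in D) g x.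
Proof.
move=> mD mg g0 f0 mN N0 fg; rewrite integral_mkcond [RHS]integral_mkcond.
apply: (completion_integral _ (@measurable_rspace_id n) _ _ (@lebnE n)
  (@lebn_complete n) _ _ N) => //.
- by apply/measurable_restrict => //; exact: measurable_funS mg.
- by move=> x; rewrite /patch; case: ifPn.
- by move=> x; rewrite /patch; case: ifPn => // _; rewrite lee_fin.
- by move=> x Nx; rewrite /patch; case: ifPn => // _; exact: fg.
Qed.

Lemma leb_integral_below n (F : n.+1.-tuple RT -> \bar R) (a : R) :
  measurable_fun setT F -> (forall x, 0 <= F x) ->
  \int[leb n.+1]_(y in [set y | (thead y <= a)%R]) F y =
  \int[lebesgue_measure]_(t in `]-oo, a]%classic) \int[leb n]_y F (tcons (t, y)).
Proof.
move=> mF F0.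
have mb : measurable [set y : n.+1.-tuple RT | (thead y <= a)%R].
  rewrite (_ : [set _ | _] = (fun y : n.+1.-tuple RT => thead y) @^-1` `]-oo, a]).
    rewrite -[X in measurable X]setTI.
    exact: (@measurable_tnth _ RT n.+1 ord0).
  by apply/seteqP; split => y /=; rewrite in_itv.
rewrite integral_mkcond leb_integralS.
- rewrite [RHS]integral_mkcond; apply: eq_integral => t _.
  rewrite /patch; case: ifPn => ta.
    apply: eq_integral => y _; rewrite mem_set//=.
    by move: ta; rewrite inE/= in_itv.
  apply: integral0_eq => y _; rewrite memNset//= => ya; move: ta.
  by rewrite notin_setE/= in_itv; apply.
- by apply/measurable_restrict => //; exact: measurable_funS mF.
- by move=> x; rewrite /patch; case: ifPn.
Qed.

Lemma measurable_slab n (I : set RT) (E : set (n.-tuple RT)) :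
  measurable I -> measurable E -> measurable (@tuncons R n @^-1` (I `*` E)).
Proof.
move=> mI mE; rewrite -[X in measurable X]setTI.
by apply: measurable_tuncons => //; exact: measurableX.
Qed.

Lemma leb_slab n (I : set RT) (E : set (n.-tuple RT)) :
  measurable I -> measurable E ->
  leb n.+1 (@tuncons R n @^-1` (I `*` E) `&` @cube R n.+1) =
  lebesgue_measure (I `&` `[0%R, 1%R]) * leb n (E `&` @cube R n).
Proof.
move=> mI mE; rewrite cubeS -preimage_setI -setXI leb_tcons//.
  exact: measurableI.
by apply: measurableI => //; exact: measurable_cube_borel.
Qed.

Lemma leb_cube_fin n (E : set (n.-tuple RT)) : measurable E ->
  leb n (E `&` @cube R n) \is a fin_num.
Proof.
move=> mE; rewrite ge0_fin_numE//; apply: (@le_lt_trans _ _ 1); last exact: ltry.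
rewrite -(@leb_cube R n); apply: le_measure; rewrite ?inE//.
- by apply: measurableI => //; exact: measurable_cube_borel.
- exact: measurable_cube_borel.
Qed.

(** A uniform variable charges no point, so this value and that of [lebesgue_unit_le] coincide;
    their equality closes the sandwich in [rosenblatt_head_law]. *)
Lemma lebesgue_unit_lt (g : R) : (0 <= g <= 1)%R ->
  lebesgue_measure ([set s : RT | (s < g)%R] `&` `[0%R, 1%R]) = g%:E.
Proof.
move=> /andP[g0 g1]; rewrite (_ : _ `&` _ = `[0%R, g[%classic).
  rewrite lebesgue_measure_itv/= lte_fin oppr0 adde0; case: ltP => // g0'.
  by congr _%:E; apply/eqP; rewrite eq_le g0 g0'.
apply/seteqP; split => [s /= [sg]|s /=]; rewrite !in_itv/= => /andP[s0 s1].
  by rewrite s0.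
by rewrite s1 s0 (le_trans (ltW s1)).
Qed.

Lemma lebesgue_unit_le (g : R) : (0 <= g <= 1)%R ->
  lebesgue_measure ([set s : RT | (s <= g)%R] `&` `[0%R, 1%R]) = g%:E.
Proof.
move=> /andP[g0 g1]; rewrite (_ : _ `&` _ = `[0%R, g]%classic).
  rewrite lebesgue_measure_itv/= lte_fin oppr0 adde0; case: ltP => // g0'.
  by congr _%:E; apply/eqP; rewrite eq_le g0 g0'.
apply/seteqP; split => [s /= [sg]|s /=]; rewrite !in_itv/= => /andP[s0 s1].
  by rewrite s0.
by rewrite s1 s0 (le_trans s1).
Qed.

End lebn_facts.

(** * Law of an inverse Rosenblatt transport *)

Section rosenblatt_step.
Context {R : realType}.
Local Notation RT := (measurableTypeR R).
Local Open Scope ereal_scope.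
Context {dO} {O : measurableType dO} {dP} {P : measurableType dP}.
Context (mu : probability O R) (p : {sigma_finite_measure set P -> \bar R}).
Context {n : nat} {f : O -> P} {U Y : O -> n.+1.-tuple RT}.
Hypotheses (mf : measurable_fun setT f) (mU : measurable_fun setT U)
  (mY : measurable_fun setT Y).
Context {h : P -> n.+1.-tuple R -> R} {h0 : P * n.+1.-tuple RT -> R}
  {N : set (P * n.+1.-tuple RT)}.
Hypotheses (h_ge0 : forall q y, (0 <= h q y)%R)
  (mh0 : measurable_fun setT h0) (h0_ge0 : forall x, (0 <= h0 x)%R)
  (mN : measurable N) (N0 : \int[p]_q leb n.+1 (xsection N q) = 0)
  (hh0 : forall q y, ~ N (q, y) -> h q y = h0 (q, y)).

(** [M0] is the density of the law of the prefix [f], and [M1] will be that of the prefix extended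
    by the first coordinate of [Y]. [K q] is the distribution function of that coordinate over [q],
    before normalisation. *)
Let M0 q := \int[leb n.+1]_y (h0 (q, y))%:E.
Let M1 (x : P * RT) := \int[leb n]_y (h0 (x.1, tcons (x.2, y)))%:E.
Let K q (a : R) := \int[lebesgue_measure]_(t in `]-oo, a]%classic) M1 (q, t).
(* [G q] is the conditional distribution function of the first coordinate;
   its quotient is [0] where the section of [h0] has mass [0] or [+oo]. *)
Let G q (a : R) : R := (fine (K q a) / fine (M0 q))%R.

Hypothesis law_fU : forall B E, measurable B -> measurable E ->
  mu (f @^-1` B `&` U @^-1` E) =
  (\int[p]_(q in B) M0 q) * leb n.+1 (E `&` @cube R n.+1).
Hypothesis ros : {ae mu, forall w,
  thead (rosenblatt (h (f w)) (Y w)) = thead (U w)}.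

Let mEh0 : measurable_fun setT (fun x => (h0 x)%:E).
Proof. exact/measurable_EFinP. Qed.

Let mM0 : measurable_fun setT M0.
Proof.
apply: (measurable_fun_fubini_tonelli_F (fun x => (h0 x)%:E)) => //.
Qed.

Let M0_ge0 q : 0 <= M0 q.
Proof. by apply: integral_ge0 => y _; rewrite lee_fin. Qed.

Let mh1 : measurable_fun setT
  (fun r : (P * RT) * n.-tuple RT => (h0 (r.1.1, tcons (r.1.2, r.2)))%:E).
Proof.
apply: (measurableT_comp mEh0); apply: measurable_fun_pair.
  exact: measurableT_comp.
apply: measurableT_comp; first exact: measurable_tcons.
by apply: measurable_fun_pair => //; exact: measurableT_comp.
Qed.

Let mM1 : measurable_fun setT M1.
Proof.
apply: (measurable_fun_fubini_tonelli_F
  (fun r : (P * RT) * n.-tuple RT => (h0 (r.1.1, tcons (r.1.2, r.2)))%:E)) => //.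
by move=> x; rewrite lee_fin.
Qed.

Let M1_ge0 x : 0 <= M1 x.
Proof. by apply: integral_ge0 => y _; rewrite lee_fin. Qed.

Let mM1q q : measurable_fun setT (fun t : RT => M1 (q, t)).
Proof. exact: measurableT_comp mM1 (pair1_measurable _). Qed.

Let mh0q q : measurable_fun setT (fun y => (h0 (q, y))%:E).
Proof. exact: measurableT_comp mEh0 (pair1_measurable _). Qed.

Let M0E q : M0 q = \int[lebesgue_measure]_t M1 (q, t).
Proof. by rewrite /M0 leb_integralS// => y; rewrite lee_fin. Qed.

Let KE q a : K q a = \int[leb n.+1]_(y in [set y | (thead y <= a)%R]) (h0 (q, y))%:E.
Proof. by rewrite leb_integral_below// => y; rewrite lee_fin. Qed.

Let K_ge0 q a : 0 <= K q a.
Proof. by apply: integral_ge0. Qed.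

Let K_le q a : K q a <= M0 q.
Proof. by rewrite M0E; apply: ge0_subset_integral. Qed.

Let K_nd q a b : (a <= b)%R -> K q a <= K q b.
Proof.
move=> ab; apply: ge0_subset_integral => //; first exact: measurable_funTS.
by move=> t /=; rewrite !in_itv/= => /le_trans; exact.
Qed.

Let G01 q a : (0 <= G q a <= 1)%R.
Proof.
have [M0oo|M0oo] := eqVneq (M0 q) +oo; first by rewrite /G M0oo invr0 mulr0 lexx ler01.
have M0fin : M0 q \is a fin_num by rewrite ge0_fin_numE// ltey.
have Kfin : K q a \is a fin_num.
  by rewrite ge0_fin_numE//; apply: le_lt_trans (K_le q a) _; rewrite ltey.
have := K_le q a; rewrite -(fineK M0fin) -(fineK Kfin) lee_fin => le.
rewrite /G divr_ge0 ?fine_ge0//=.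
have [->|M0n0] := eqVneq (fine (M0 q)) 0%R; first by rewrite invr0 mulr0 ler01.
by rewrite ler_pdivrMr ?mul1r// lt_neqAle eq_sym M0n0 fine_ge0.
Qed.

Let mK a : measurable_fun setT (fun q => K q a).
Proof.
have mF : measurable_fun setT
    ((fun x : P * RT => M1 x) \_ [set x : P * RT | `]-oo, a]%classic x.2]).
  apply/measurable_restrict => //; last exact: measurable_funTS.
  rewrite -[X in measurable X]setTI.
  by apply: (@measurable_snd _ _ P RT) => //; exact: measurable_itv.
have F0 x : 0 <= ((fun x : P * RT => M1 x) \_ [set x : P * RT | `]-oo, a]%classic x.2]) x.
  by rewrite /patch; case: ifPn.
apply: eq_measurable_fun (measurable_fun_fubini_tonelli_F (m2 := lebesgue_measure) _ mF F0).
move=> q _; rewrite /K integral_mkcond; apply: eq_integral => t _.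
by rewrite /patch /=; congr (if _ then _ else _).
Qed.

Let mG a : measurable_fun setT (fun q => G q a).
Proof.
apply: measurable_funM; first exact: measurableT_comp (mK a).
by apply: measurable_funV; exact: measurableT_comp mM0.
Qed.

Let mass1 : \int[p]_q M0 q = 1.
Proof.
have := law_fU setT setT measurableT measurableT.
rewrite !preimage_setT setIT probability_setT setTI leb_cube mule1.
by move=> <-.
Qed.

(** The bad prefixes: over the first kind [h] and [h0] may have different integrals, over the second
    the quotient [G] is degenerate. They form a [p]-null set, so [f] almost surely avoids them. *)
Let Z := [set q | leb n.+1 (xsection N q) != 0] `|` [set q | M0 q = +oo].

Let mZ : measurable Z.
Proof.
apply: measurableU.
  have mX : measurable_fun setT (fun q => leb n.+1 (xsection N q)).
    exact: measurable_fun_xsection.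
  by have := emeasurable_neq measurableT mX 0; rewrite setTI.
have -> : [set q | M0 q = +oo] = setT `&` M0 @^-1` [set +oo] by rewrite setTI.
exact: mM0.
Qed.

Let pZ : p Z = 0.
Proof.
have mX : measurable_fun setT (fun q => leb n.+1 (xsection N q)).
  exact: measurable_fun_xsection.
rewrite /Z; apply/negligibleP => //; apply: negligibleU.
- have /(ae_eq_integral_abs p measurableT mX) :
      \int[p]_(q in setT) `|leb n.+1 (xsection N q)| = 0.
    by rewrite -[RHS]N0; apply: eq_integral => q _; rewrite gee0_abs.
  apply: negligibleS => q /= /eqP Nq; by move=> H; apply: Nq; exact: H.
- have /integrable_ae : p.-integrable setT M0.
    apply/integrableP; split => //.
    rewrite (eq_integral M0) ?mass1 ?ltry// => q _.
    by rewrite gee0_abs.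
  move=> /(_ measurableT); apply: negligibleS => q /= M0q.
  by move=> /(_ I); rewrite M0q.
Qed.

Let mu_fZ : mu (f @^-1` Z) = 0.
Proof.
rewrite -[X in mu X]setIT -(preimage_setT U) law_fU//.
rewrite null_set_integral// ?mul0e//; exact: measurable_funTS.
Qed.

Let mtU : measurable_fun setT (fun w => thead (U w)).
Proof. by apply: measurableT_comp mU; exact: (@measurable_tnth _ RT n.+1 ord0). Qed.

Let mtY : measurable_fun setT (fun w => thead (Y w)).
Proof. by apply: measurableT_comp mY; exact: (@measurable_tnth _ RT n.+1 ord0). Qed.

Let mbU : measurable_fun setT (fun w => [tuple of behead (U w)]).
Proof. exact: (measurableT_comp (@measurable_behead _ RT n) mU). Qed.

Let U' w : n.-tuple RT := [tuple of behead (U w)].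

(** On the event [U' w \in E], the pair of [f] and the head of [U] has a product law, so the
    probability of [D] is obtained by integrating the lengths of its sections. The length [G q a]
    against the density [M0 q] gives back [K q a]. *)
Let law_slab (E : set (n.-tuple RT)) (B : set P) (a : R) (D : set (P * RT)) :
  measurable E -> measurable B -> measurable D ->
  (forall q, lebesgue_measure (xsection D q `&` `[0%R, 1%R]) =
     (\1_B q * G q a)%:E) ->
  mu ((fun w => (f w, thead (U w))) @^-1` D `&` U' @^-1` E) =
  (\int[p]_(q in B) K q a) * leb n (E `&` @cube R n).
Proof.
move=> mE mB mD DG.
have mE' : measurable (U' @^-1` E).
  by have := mbU measurableT _ mE; rewrite setTI.
have mfU : measurable_fun setT (fun w => (f w, thead (U w))).
  exact: measurable_fun_pair.
pose m := measure_function_pushforward__canonical__measure_function_Measure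
  (mrestr mu mE') mfU.
pose m1 := measure_function_pushforward__canonical__measure_function_Measure mu mf.
have mC : measurable (@tuncons R n @^-1` (setT `*` E) `&` @cube R n.+1).
  apply: measurableI; last exact: measurable_cube_borel.
  exact: measurable_slab.
have mth : measurable_fun setT (fun y : n.+1.-tuple RT => thead y).
  exact: (@measurable_tnth _ RT n.+1 ord0).
pose m2 := measure_function_pushforward__canonical__measure_function_Measure
  (mrestr (leb n.+1) mC) mth.
have m2E (I : set RT) : measurable I ->
    m2 I = leb n.+1 (@tuncons R n @^-1` (I `*` E) `&` @cube R n.+1).
  move=> mI; rewrite /m2 /= /pushforward /mrestr; congr (leb n.+1 _).
  by apply/seteqP; split => [y /= [? [[_ ?]]]|y /= [[? ?]]].
transitivity (m D) => //.
have m2oo : m2 setT < +oo.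
  rewrite m2E// -ge0_fin_numE//; apply: leb_cube_fin.
  exact: measurable_slab.
have moo : m setT < +oo.
  rewrite /m /= /pushforward /mrestr preimage_setT setTI.
  by apply: le_lt_trans (probability_le1 mu mE') _; exact: ltry.
rewrite (measure_rectangle_product m m1 m2)//; last first.
  move=> A I mA mI; rewrite m2E// /m /= /pushforward /mrestr.
  pose EI := @tuncons R n @^-1` (I `*` E).
  have mEI : measurable EI.
    exact: measurable_slab.
  transitivity (mu (f @^-1` A `&` U @^-1` EI)).
    by congr (mu _); apply/seteqP; split => [w /= [[? ?] ?]|w /= [? [? ?]]].
  rewrite law_fU//; congr (_ * _).
  have := law_fU A setT mA measurableT.
  by rewrite preimage_setT setIT setTI leb_cube mule1.
have c0 : 0 <= leb n (E `&` @cube R n) by exact: measure_ge0.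
have mBG : measurable_fun setT (fun q => (\1_B q * G q a)%:E).
  by apply/measurable_EFinP; apply: measurable_funM => //; exact: measurable_indic.
have BG0 q : 0 <= (\1_B q * G q a)%:E.
  by rewrite lee_fin mulr_ge0//; have /andP[] := G01 q a.
transitivity (\int[m1]_q ((\1_B q * G q a)%:E * leb n (E `&` @cube R n))).
  apply: eq_integral => q _; rewrite m2E; last exact: measurable_xsection.
  by rewrite leb_slab ?DG//; exact: measurable_xsection.
rewrite ge0_integralZr//; congr (_ * _).
rewrite (integral_weighted p m1 M0)//; last first.
  move=> A mA; have := law_fU A setT mA measurableT.
  by rewrite preimage_setT setIT setTI leb_cube mule1.
rewrite [RHS]integral_mkcond; apply: ge0_ae_eq_integral => //.
- exact: emeasurable_funM.
- by apply/measurable_restrict => //; exact: measurable_funTS.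
- by move=> q _; rewrite mule_ge0.
- by move=> q _; rewrite /patch; case: ifPn.
- exists Z; split => // q /=; apply: contra_notP => /not_orP[/= _ M0q] _.
  rewrite /patch indicE; case: ifPn => qB; last by rewrite mul0r mul0e.
  have M0fin : M0 q \is a fin_num by rewrite ge0_fin_numE// ltey; exact/eqP.
  have Kfin : K q a \is a fin_num.
    rewrite ge0_fin_numE//; apply: le_lt_trans (K_le q a) _.
    by rewrite ltey; exact/eqP.
  rewrite mul1r -(fineK M0fin) -EFinM /G -(fineK Kfin)/=.
  (* Where the section has mass 0, [G] is 0 by the convention [x / 0 = 0], and [K <= M0] forces [K]
     to vanish as well; so [G * M0 = K] persists. *)
  have [M00|M00] := eqVneq (fine (M0 q)) 0%R; last by rewrite divfK.
  rewrite M00 mulr0; congr _%:E; apply/eqP; rewrite eq_le fine_ge0//=.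
  by rewrite -M00 fine_le.
Qed.

(** Off [Z] the sections of [h] and [h0] agree almost everywhere, so what [rosenblatt] computes from
    [h] with the completed measure is the Borel distribution function [G]. *)
Let hG q a : ~ Z q ->
  (fine (\int[lebn n.+1]_(y in [set y : n.+1.-tuple R | (thead y <= a)%R]) (h q y)%:E) /
   fine (\int[lebn n.+1]_y (h q y)%:E))%R = G q a.
Proof.
move=> nZ; have Nq0 : leb n.+1 (xsection N q) = 0.
  by apply/eqP; apply: contra_notT nZ => Nq; left.
have mNq : measurable (xsection N q) by exact: measurable_xsection.
have mb : measurable [set y : n.+1.-tuple RT | (thead y <= a)%R].
  rewrite (_ : [set _ | _] = (fun y : n.+1.-tuple RT => thead y) @^-1` `]-oo, a]).
    rewrite -[X in measurable X]setTI.
    exact: (@measurable_tnth _ RT n.+1 ord0).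
  by apply/seteqP; split => y /=; rewrite in_itv.
have hh0q y : ~ xsection N q y -> (h q y)%:E = (h0 (q, y))%:E.
  by move=> Ny; rewrite hh0// => Nqy; apply: Ny; rewrite /xsection/= inE.
have h0q0 y : 0 <= (h0 (q, y))%:E by rewrite lee_fin.
rewrite (lebn_integral n.+1 _ _ (h q) (fun y => (h0 (q, y))%:E) mb _ _ _ mNq)//.
rewrite (lebn_integral n.+1 _ _ (h q) (fun y => (h0 (q, y))%:E) measurableT _ _ _ mNq)//.
by rewrite /G KE.
Qed.

Let headE w : thead (rosenblatt (h (f w)) (Y w)) =
  (fine (\int[lebn n.+1]_(y in [set y : n.+1.-tuple R | (thead y <= thead (Y w))%R])
     (h (f w) y)%:E) /
   fine (\int[lebn n.+1]_y (h (f w) y)%:E))%R.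
Proof. by []. Qed.

(* As [G (f w)] is nondecreasing and [thead (U w) = G (f w) (thead (Y w))],
   [{thead (Y w) < a}] lies between [{thead (U w) < G (f w) a}] and
   [{thead (U w) <= G (f w) a}], whose probabilities agree: no injectivity of
   the distribution function is needed. *)
Lemma rosenblatt_head_law (A : set (P * RT)) (E : set (n.-tuple RT)) :
  measurable A -> measurable E ->
  mu ((fun w => (f w, thead (Y w))) @^-1` A `&` U' @^-1` E) =
  (\int[p \x lebesgue_measure]_(x in A) M1 x) * leb n (E `&` @cube R n).
Proof.
move=> mA mE.
have mE' : measurable (U' @^-1` E) by have := mbU measurableT _ mE; rewrite setTI.
have mfY : measurable_fun setT (fun w => (f w, thead (Y w))).
  exact: measurable_fun_pair.
have mfU : measurable_fun setT (fun w => (f w, thead (U w))).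
  exact: measurable_fun_pair.
have cfin : leb n (E `&` @cube R n) \is a fin_num by exact: leb_cube_fin.
have c0 : 0 <= leb n (E `&` @cube R n) by exact: measure_ge0.
pose m := measure_function_pushforward__canonical__measure_function_Measure
  (mrestr mu mE') mfY.
pose m' := mscale (NngNum (fine_ge0 c0)) (weighted (p \x lebesgue_measure) M1 mM1 M1_ge0).
have m'E X : m' X = (\int[p \x lebesgue_measure]_(x in X) M1 x) * leb n (E `&` @cube R n).
  by rewrite /m' /mscale/= fineK// muleC.
rewrite -m'E; transitivity (m A) => //; apply: measure_ray_unique mA.
  rewrite /m /= /pushforward /mrestr preimage_setT setTI.
  by apply: le_lt_trans (probability_le1 mu mE') _; exact: ltry.
move=> B a mB; apply: etrans (esym (m'E _)).
have -> : \int[p \x lebesgue_measure]_(x in B `*` `]-oo, a[%classic) M1 x =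
    \int[p]_(q in B) K q a.
  rewrite integral_mkcond fubini_tonelli1.
  - rewrite [RHS]integral_mkcond; apply: eq_integral => q _.
    rewrite /fubini_F [in RHS]/patch; case: ifPn => qB.
      (* The test ray is open while [K], like the Rosenblatt map, uses a closed ray; a point has
         Lebesgue measure 0. *)
      rewrite /K -integral_itv_bndo_bndc; last first.
        exact: (measurable_funTS (mM1q q)).
      rewrite [RHS]integral_mkcond; apply: eq_integral => t _; rewrite /patch.
      by rewrite in_setX qB.
    by apply: integral0_eq => t _; rewrite /patch in_setX (negbTE qB).
  - apply/measurable_restrict => //; last exact: measurable_funTS.
    by apply: measurableX => //; exact: measurable_itv.
  - by move=> x; rewrite /patch; case: ifPn.
have mGx : measurable_fun setT (fun x : P * RT => G x.1 a).
  exact: measurableT_comp (mG a) (@measurable_fst _ _ P RT).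
have mBT : measurable (B `*` [set: RT]) by exact: measurableX.
have mt : measurable [set true] by [].
have mlt : measurable [set x : P * RT | B x.1 /\ (x.2 < G x.1 a)%R].
  have mb : measurable_fun setT (fun x : P * RT => (x.2 < G x.1 a)%R).
    exact: measurable_fun_ltr.
  rewrite (_ : [set x | _] = (B `*` setT) `&`
      (setT `&` (fun x : P * RT => (x.2 < G x.1 a)%R) @^-1` [set true])).
    exact: (measurableI _ _ mBT (mb measurableT _ mt)).
  by apply/seteqP; split => [x /= [? ?]|x /= [[? _] [_ ?]]].
have mle : measurable [set x : P * RT | B x.1 /\ (x.2 <= G x.1 a)%R].
  have mb : measurable_fun setT (fun x : P * RT => (x.2 <= G x.1 a)%R).
    exact: measurable_fun_ler.
  rewrite (_ : [set x | _] = (B `*` setT) `&`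
      (setT `&` (fun x : P * RT => (x.2 <= G x.1 a)%R) @^-1` [set true])).
    exact: (measurableI _ _ mBT (mb measurableT _ mt)).
  by apply/seteqP; split => [x /= [? ?]|x /= [[? _] [_ ?]]].
have [Bad [mBad Bad0 rosB]] := ros.
have mfZ : measurable (f @^-1` Z) by have := mf measurableT _ mZ; rewrite setTI.
have nullZ : mu (Bad `|` f @^-1` Z) = 0 by rewrite measureU0.
have lo : mu ((fun w => (f w, thead (U w))) @^-1`
      [set x : P * RT | B x.1 /\ (x.2 < G x.1 a)%R] `&` U' @^-1` E) =
    (\int[p]_(q in B) K q a) * leb n (E `&` @cube R n).
  apply: law_slab => // q; rewrite indicE; case: (boolP (q \in B)) => qB.
    rewrite mul1r -(lebesgue_unit_lt _ (G01 q a)); congr (lebesgue_measure _); congr (_ `&` _).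
    apply/seteqP; split => [s|s sG]; rewrite /xsection/= inE/=; first by case.
    by split => //; exact/set_mem.
  rewrite mul0r (_ : _ `&` _ = set0) ?measure0//.
  apply/seteqP; split => // s [/=]; rewrite /xsection/= inE/= => -[Bq _].
  by move: qB; rewrite mem_set.
have hi : mu ((fun w => (f w, thead (U w))) @^-1`
      [set x : P * RT | B x.1 /\ (x.2 <= G x.1 a)%R] `&` U' @^-1` E) =
    (\int[p]_(q in B) K q a) * leb n (E `&` @cube R n).
  apply: law_slab => // q; rewrite indicE; case: (boolP (q \in B)) => qB.
    rewrite mul1r -(lebesgue_unit_le _ (G01 q a)); congr (lebesgue_measure _); congr (_ `&` _).
    apply/seteqP; split => [s|s sG]; rewrite /xsection/= inE/=; first by case.
    by split => //; exact/set_mem.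
  rewrite mul0r (_ : _ `&` _ = set0) ?measure0//.
  apply/seteqP; split => // s [/=]; rewrite /xsection/= inE/= => -[Bq _].
  by move: qB; rewrite mem_set.
have mBZ : measurable (Bad `|` f @^-1` Z) by exact: measurableU.
have UG w : ~ (Bad `|` f @^-1` Z) w -> thead (U w) = G (f w) (thead (Y w)).
  move=> /not_orP[nB nZ]; rewrite -(hG _ _ nZ) -headE; apply/esym.
  by apply: contrapT => H; apply: nB; exact: rosB.
have Gnd q : ~ Z q -> {homo G q : x y / (x <= y)%R}.
  move=> nZ x y xy; have M0fin : M0 q \is a fin_num.
    by rewrite ge0_fin_numE// ltey; apply/eqP => M0q; apply: nZ; right.
  have Kfin z : K q z \is a fin_num.
    by rewrite ge0_fin_numE//; apply: le_lt_trans (K_le q z) _; rewrite -ge0_fin_numE.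
  by rewrite /G ler_wpM2r ?invr_ge0 ?fine_ge0// fine_le// K_nd.
have mpre (D : set (P * RT)) : measurable D ->
    measurable ((fun w => (f w, thead (U w))) @^-1` D `&` U' @^-1` E).
  by move=> mD; apply: measurableI => //; have := mfU measurableT _ mD; rewrite setTI.
have mS : measurable ((fun w => (f w, thead (Y w))) @^-1` (B `*` `]-oo, a[%classic)
    `&` U' @^-1` E).
  apply: measurableI => //.
  have := mfY measurableT _ (measurableX mB (measurable_itv `]-oo, a[)).
  by rewrite setTI.
rewrite /m /= /pushforward /mrestr; apply/eqP; rewrite eq_le; apply/andP; split.
- rewrite -hi -(measureU0 (mpre _ mle) mBZ nullZ); apply: le_measure.
  + by rewrite inE.
  + by rewrite inE; apply: measurableU => //; exact: mpre.
  + move=> w /= [[Bw +] Ew]; rewrite in_itv/= => Ya.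
    have [|nBZ] := pselect ((Bad `|` f @^-1` Z) w); [by right|left; split => //].
    split => //=; rewrite UG//; apply: Gnd; last exact: ltW.
    by move=> Zw; apply: nBZ; right.
- rewrite -lo -(measureU0 mS mBZ nullZ); apply: le_measure.
  + by rewrite inE; exact: mpre.
  + by rewrite inE; exact: measurableU.
  + move=> w /= [[Bw Ga] Ew].
    have [|nBZ] := pselect ((Bad `|` f @^-1` Z) w); [by right|left; split => //].
    split => //=; rewrite in_itv/= ltNge; apply/negP => aY.
    move: Ga; rewrite UG// ltNge => /negP; apply; apply: Gnd => //.
    by move=> Zw; apply: nBZ; right.
Qed.

End rosenblatt_step.

Section rosenblatt_law.
Context {R : realType}.
Local Notation RT := (measurableTypeR R).
Local Open Scope ereal_scope.

(* The coordinates already transported are abstracted as a random element [f] of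
   an arbitrary space [P] with reference measure [p]. [f] is independent of the
   remaining uniform coordinates [U] and has the marginal of [h0] as density;
   [h] agrees with its Borel version [h0] off the null set [N]. *)
Lemma rosenblatt_law n {dO} {O : measurableType dO} {dP} {P : measurableType dP}
    (mu : probability O R) (p : {sigma_finite_measure set P -> \bar R})
    (f : O -> P) (U Y : O -> n.-tuple RT)
    (h : P -> n.-tuple R -> R) (h0 : P * n.-tuple RT -> R)
    (N : set (P * n.-tuple RT)) :
  measurable_fun setT f -> measurable_fun setT U -> measurable_fun setT Y ->
  (forall q y, (0 <= h q y)%R) ->
  measurable_fun setT h0 -> (forall x, (0 <= h0 x)%R) ->
  measurable N -> \int[p]_q leb n (xsection N q) = 0 ->
  (forall q y, ~ N (q, y) -> h q y = h0 (q, y)) ->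
  (forall B E, measurable B -> measurable E ->
    mu (f @^-1` B `&` U @^-1` E) =
    (\int[p]_(q in B) \int[leb n]_y (h0 (q, y))%:E) * leb n (E `&` @cube R n)) ->
  {ae mu, forall w, rosenblatt (h (f w)) (Y w) = U w} ->
  forall A, measurable A ->
  mu ((fun w => (f w, Y w)) @^-1` A) =
  \int[p]_q \int[leb n]_y (\1_A (q, y) * h0 (q, y))%:E.
Proof.
elim: n dO O dP P mu p f U Y h h0 N => [|n IH] dO O dP P mu p f U Y h h0 N
  mf mU mY h_ge0 mh0 h0_ge0 mN N0 hh0 law ros A mA.
  have mh0E : measurable_fun setT (fun x => (h0 x)%:E) by exact/measurable_EFinP.
  have mAh : measurable_fun setT (fun x => (\1_A x * h0 x)%:E).
    by apply/measurable_EFinP/measurable_funM => //; exact: measurable_indic.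
  (* In dimension 0 the tuple space is a single point: [A] is determined by its slice [B], and [law]
     with the full cube is the claim. *)
  pose B := [set q | A (q, [tuple])].
  have mB : measurable B.
    rewrite -[X in measurable X]setTI.
    exact: (@pair2_measurable _ _ P (0.-tuple RT) [tuple]).
  have := law B setT mB measurableT.
  rewrite preimage_setT setIT setTI leb_cube mule1.
  rewrite (_ : f @^-1` B = (fun w => (f w, Y w)) @^-1` A); last first.
    by apply/funext => w /=; rewrite /B/= (tuple0 (Y w)).
  move=> ->; rewrite integral_mkcond; apply: eq_integral => q _.
  rewrite /= integral_dirac//=; last exact: measurableT_comp mAh (pair1_measurable q).
  rewrite diracT mul1e /patch indicE; case: ifPn => qB.
    rewrite integral_dirac//=; last exact: measurableT_comp mh0E (pair1_measurable q).
    by rewrite diracT mul1e mem_set ?mul1r//; exact/set_mem.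
  by rewrite memNset ?mul0r// => Aq; move: qB; rewrite mem_set.
(* Reassociation of prefix, next coordinate and remaining tuple; it carries [A], [N] and [h0] over
   to the longer prefix. *)
pose al (r : (P * RT) * n.-tuple RT) : P * n.+1.-tuple RT := (r.1.1, tcons (r.1.2, r.2)).
have mal : measurable_fun setT al.
  apply: measurable_fun_pair; first exact: measurableT_comp.
  apply: measurableT_comp; first exact: measurable_tcons.
  by apply: measurable_fun_pair => //; exact: measurableT_comp.
have mtY : measurable_fun setT (fun w => thead (Y w)).
  by apply: measurableT_comp mY; exact: (@measurable_tnth _ RT n.+1 ord0).
have mbeh := @measurable_behead _ RT n.
have mal1 (X : set (P * n.+1.-tuple RT)) : measurable X -> measurable (al @^-1` X).
  by move=> mX; have := mal measurableT _ mX; rewrite setTI.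
have YE w : tcons (thead (Y w), [tuple of behead (Y w)]) = Y w.
  exact: (tunconsK (Y w)).
have -> : (fun w => (f w, Y w)) @^-1` A =
    (fun w => ((f w, thead (Y w)), [tuple of behead (Y w)])) @^-1` (al @^-1` A).
  by apply/funext => w; rewrite /= /al /= YE.
(* The first transported coordinate joins the prefix and the first uniform coordinate is spent. The
   section of [h] at the longer prefix is the one on which [rosenblatt] recurses. *)
rewrite (IH _ O _ (P * RT)%type mu (sf_product p lebesgue_measure)
  (fun w => (f w, thead (Y w))) (fun w => [tuple of behead (U w)])
  (fun w => [tuple of behead (Y w)])
  (fun q y => h q.1 [tuple of q.2 :: y]) (h0 \o al) (al @^-1` N)) //.
- rewrite [RHS](leb_integralA p n (fun x => (\1_A x * h0 x)%:E))//.
  + by apply/measurable_EFinP/measurable_funM => //; exact: measurable_indic.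
  + by move=> x; rewrite lee_fin mulr_ge0.
- exact: measurable_fun_pair.
- exact: measurableT_comp mbeh mU.
- exact: measurableT_comp mbeh mY.
- exact: measurableT_comp.
- by move=> x; exact: h0_ge0.
- exact: mal1.
(* Nullity of almost all sections of [N] is rewritten with indicators, so that [leb_integralA]
   transfers it to the longer prefixes. *)
- have mind : measurable_fun setT (fun x => (\1_N x)%:E : \bar R).
    by apply/measurable_EFinP; exact: measurable_indic.
  have indE dT (T : measurableType dT) (m : {measure set T -> \bar R}) (X : set T) :
      measurable X -> m X = \int[m]_x (\1_X x)%:E.
    by move=> mX; rewrite integral_indic// setIT.
  transitivity (\int[p]_q \int[leb n.+1]_y (\1_N (q, y))%:E); last first.
    rewrite -[RHS]N0; apply: eq_integral => q _.
    rewrite [RHS]indE; last exact: measurable_xsection.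
    by apply: eq_integral => y _; rewrite !indicE mem_xsection.
  rewrite (leb_integralA p n (fun x => (\1_N x)%:E))//.
  apply: eq_integral => q _; rewrite indE; last exact: measurable_xsection (mal1 _ mN).
  apply: eq_integral => y _; rewrite !indicE mem_xsection.
  by congr (_%:R%:E).
- by move=> q y Nq; rewrite hh0.
- move=> B E mB mE.
  apply: (rosenblatt_head_law mu p mf mU mY h_ge0 mh0 h0_ge0 mN N0 hh0 law) => //.
  by apply: filterS ros => w ->.
- apply: filterS ros => w <-.
  exact: val_inj.
- exact: mal1.
Qed.

End rosenblatt_law.

Section inverse_rosenblatt_law.
Context {R : realType}.
Local Notation RT := (measurableTypeR R).
Local Open Scope ereal_scope.

Lemma inverse_rosenblatt_borel n (X : set (n.-tuple R)) (h : n.-tuple R -> R)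
    (h0 : n.-tuple RT -> R) (N : set (n.-tuple RT))
    (T : {mfun rspace R n >-> rspace R n}) :
  (forall x, (0 <= h x)%R) -> measurable_fun setT h0 ->
  (forall x, (0 <= h0 x)%R) -> measurable N -> leb n N = 0 ->
  (forall x, ~ N x -> h x = h0 x) -> \int[leb n]_x (h0 x)%:E = 1 ->
  inverse_rosenblatt X h T ->
  forall A : set (n.-tuple RT), measurable A ->
    @unif_cube R n (T @^-1` A) = \int[leb n]_(x in A) (h0 x)%:E.
Proof.
move=> h_ge0 mh0 h0_ge0 mN N0 hh0 mass Tinv A mA.
(* The empty prefix: at the start nothing has been transported, so [P] is a one-point space with its
   Dirac mass. *)
pose pt : {sigma_finite_measure set unit -> \bar R} := \d_ tt.
have mT : measurable_fun setT (fun w : rspace R n => T w : n.-tuple RT).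
  by apply: measurableT_comp (@measurable_rspace_id R n) _.
have msnd := @measurable_snd _ _ unit (n.-tuple RT).
have msndP (B : set (n.-tuple RT)) : measurable B ->
    measurable (@snd unit (n.-tuple RT) @^-1` B).
  by move=> mB; have := msnd measurableT _ mB; rewrite setTI.
have integral_pt (f : unit -> \bar R) : \int[pt]_q f q = f tt.
  by rewrite integral_dirac ?diracT ?mul1e.
have snd_section (B : set (n.-tuple RT)) (q : unit) :
    xsection (@snd unit (n.-tuple RT) @^-1` B) q = B.
  by apply/seteqP; split => x; rewrite /xsection/= inE.
have := @rosenblatt_law R n _ (rspace R n) _ unit (@unif_cube R n) pt
  (fun=> tt) id T (fun=> h) (h0 \o snd) (snd @^-1` N).
move=> /(_ (measurable_cst _) (@measurable_rspace_id R n) mT (fun=> h_ge0)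
  (measurableT_comp mh0 msnd) (fun x => h0_ge0 x.2) (msndP _ mN)).
rewrite integral_pt snd_section => /(_ N0 (fun _ => hh0)) H.
transitivity (@unif_cube R n ((fun w => (tt, T w)) @^-1` (snd @^-1` A))) => //.
have law B (E : set (n.-tuple RT)) : measurable B -> measurable E ->
    @unif_cube R n ((fun=> tt) @^-1` B `&` (fun w : rspace R n => w : n.-tuple RT) @^-1` E) =
    (\int[pt]_(q in B) \int[leb n]_y ((h0 \o snd) (q, y))%:E) *
    leb n (E `&` @cube R n).
  move=> mB mE; rewrite integral_mkcond integral_pt patchE mass /unif_cube /mrestr.
  have [Btt|Btt] := pselect (B tt).
    rewrite mem_set// mul1e (_ : _ @^-1` B = setT) ?setTI.
      by apply: lebnE; exact: (measurableI E _ mE (@measurable_cube_borel R n)).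
    by apply/seteqP; split.
  rewrite memNset// mul0e (_ : _ @^-1` B = set0) ?set0I ?measure0//.
  by apply/seteqP; split.
have ros : {ae @unif_cube R n, forall w, rosenblatt h (T w) = w}.
  by case: Tinv => M [mM M0 TM]; exists M; split => // w nr; apply: TM => -[].
rewrite (H law ros _ (msndP _ mA)) integral_pt [RHS]integral_mkcond.
apply: eq_integral => y _; rewrite indicE /patch /=.
case: ifPn => yA.
  by rewrite mem_set ?mul1r//; exact/set_mem.
by rewrite memNset ?mul0r// => Ay; move: yA; rewrite mem_set.
Qed.

(** A Lebesgue measurable [A] is Borel up to a Borel null set [M]. The Borel case applied to [M]
    shows that the law of [T] does not charge it either, so both sides may be computed on the Borel
    set [A] minus [M]. *)
Lemma inverse_rosenblatt_density n (X : set (n.-tuple R)) (h : n.-tuple R -> R)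
    (h0 : n.-tuple RT -> R) (N : set (n.-tuple RT))
    (T : {mfun rspace R n >-> rspace R n}) :
  (forall x, (0 <= h x)%R) -> measurable_fun setT h0 ->
  (forall x, (0 <= h0 x)%R) -> measurable N -> leb n N = 0 ->
  (forall x, ~ N x -> h x = h0 x) -> \int[leb n]_x (h0 x)%:E = 1 ->
  inverse_rosenblatt X h T ->
  is_density (distribution (@unif_cube R n) T) h.
Proof.
move=> h_ge0 mh0 h0_ge0 mN N0 hh0 mass Tinv.
have mh : measurable_fun (setT : set (rspace R n)) h.
  apply/measurable_EFinP.
  apply: (completion_measurable_fun _ (@measurable_rspace_id R n) _ _ (@lebnE R n)
    (@lebn_complete R n) _ (fun x => (h0 x)%:E) _ _ mN N0).
    exact/measurable_EFinP.
  by move=> x nN; rewrite /= hh0.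
split => //.
have borel (A : set (n.-tuple RT)) : measurable A ->
    distribution (@unif_cube R n) T A = \int[lebn n]_(x in A) (h x)%:E.
  move=> mA; rewrite (lebn_integral n A N h (fun x => (h0 x)%:E))//.
  - exact: (inverse_rosenblatt_borel n X h h0 N T).
  - exact/measurable_EFinP.
  - by move=> x nN; rewrite hh0.
move=> A mA.
have [M [mM M0 mAM]] : exists M : set (n.-tuple RT),
    [/\ measurable M, leb n M = 0 & measurable (A `\` M : set (n.-tuple RT))].
  exact: (caratheodory_borel (leb n) A (sigma_finiteT (leb n)) mA).
have mMr : measurable (M : set (rspace R n)) by exact: caratheodory_measurable_mu_ext.
have TM0 : distribution (@unif_cube R n) T M = 0.
  rewrite (borel _ mM); apply: null_set_integral; first exact: mMr.
    by apply/measurable_EFinP; exact: measurable_funTS.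
  by apply: etrans (lebnE _ _ mM) M0.
transitivity (distribution (@unif_cube R n) T (A `\` M)).
  have mAMr : measurable (A `\` M : set (rspace R n)) by exact: measurableD.
  have mIr : measurable (A `&` M : set (rspace R n)) by exact: measurableI.
  rewrite -[in LHS](setUIDK A M) setUC measureU0//.
  exact: (subset_measure0 mIr mMr (@subIsetr _ _ _) TM0).
rewrite (borel _ mAM); apply/esym; apply: (ge0_negligible_integral mMr mA).
- by apply/measurable_EFinP; exact: measurable_funTS.
- by move=> x _; rewrite lee_fin.
- by apply: etrans (lebnE _ _ mM) M0.
Qed.

End inverse_rosenblatt_law.

(** * The weighted box *)

Section weight_measurability.
Context {R : realType}.
Local Notation RT := (measurableTypeR R).
Local Open Scope ereal_scope.

(** Here the completion is built from the length of intervals instead of [leb], so the argument goes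
    through the description of Caratheodory sets as Borel sets united with subsets of null sets. *)
Lemma lreal_borel (A : set (lreal R)) : measurable A ->
  exists N : set RT, [/\ measurable N, lebesgue_measure N = 0 & measurable (A `\` N : set RT)].
Proof.
move=> mA; have : (@wlength R idfun)^*%mu.-cara.-measurable A by [].
rewrite -completed_caratheodory_measurable g_sigma_completed_algebra_genE.
move=> [B mB [M [N [mN N0 MN]] <-]]; exists N; split => //.
rewrite (_ : _ `\` _ = B `\` N); first exact: measurableD.
rewrite setDUl (_ : M `\` N = set0) ?setU0//.
by apply/seteqP; split => // t [Mt]; apply; exact: MN.
Qed.

Lemma measurable_lreal_id : measurable_fun setT (fun t : lreal R => t : RT).
Proof. by move=> _ A mA; rewrite setTI; exact: sub_caratheodory. Qed.

Lemma completed_lebesgue_measureE (A : set RT) : measurable A ->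
  completed_lebesgue_measure A = lebesgue_measure A.
Proof. by []. Qed.

Lemma leb_integral_prod n (l : 'I_n -> RT -> R) :
  (forall i, measurable_fun setT (l i)) -> (forall i t, (0 <= l i t)%R) ->
  \int[leb n]_x (\prod_(i < n) l i (tnth x i))%:E =
  \prod_(i < n) \int[lebesgue_measure]_t (l i t)%:E.
Proof.
elim: n l => [|n IH] l ml l0.
  under eq_integral do rewrite big_ord0.
  by rewrite big_ord0 integral_cst//= mul1e diracT.
have mp : measurable_fun setT (fun x : n.+1.-tuple RT =>
    (\prod_(i < n.+1) l i (tnth x i))%:E).
  apply/measurable_EFinP; apply: measurable_prod => i _.
  exact: measurableT_comp (ml i) (@measurable_tnth _ RT n.+1 i).
rewrite leb_integralS//; last by move=> x; rewrite lee_fin prodr_ge0.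
rewrite big_ord_recl -IH//.
rewrite -ge0_integralZr//; last 3 first.
- exact/measurable_EFinP.
- by move=> t _; rewrite lee_fin.
- by apply: integral_ge0 => y _; rewrite lee_fin prodr_ge0.
apply: eq_integral => t _.
rewrite -ge0_integralZl//; last 3 first.
- apply/measurable_EFinP; apply: measurable_prod => i _.
  exact: measurableT_comp (ml _) (@measurable_tnth _ RT n i).
- by move=> y _; rewrite lee_fin prodr_ge0.
- by rewrite lee_fin.
apply: eq_integral => y _; rewrite -EFinM big_ord_recl; congr (_ * _)%:E.
by apply: eq_bigr => i _; rewrite tnthS.
Qed.

Lemma leb_tnth_null n (i : 'I_n) (N : set RT) : measurable N ->
  lebesgue_measure N = 0 -> leb n ((fun x => tnth x i) @^-1` N) = 0.
Proof.
move=> mN N0; have mi := @measurable_tnth _ RT n i.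
have mpre : measurable ((fun x : n.-tuple RT => tnth x i) @^-1` N).
  by have := mi measurableT _ mN; rewrite setTI.
rewrite -(setIT (_ @^-1` _)) -integral_indic//.
(* The indicator of the preimage is a product with [\1_N] in slot [i] and 1 elsewhere. The other
   factors have infinite integral, but the factor 0 wins since [0 * +oo = 0]. *)
pose l j : RT -> R := if j == i then \1_N else cst 1%R.
transitivity (\int[leb n]_x (\prod_(j < n) l j (tnth x j))%:E).
  apply: eq_integral => x _; congr _%:E.
  rewrite (bigD1 i)//= big1 ?mulr1; first by rewrite /l eqxx !indicE.
  by move=> j ji; rewrite /l (negbTE ji).
rewrite leb_integral_prod.
- have li0 : \int[lebesgue_measure]_t (l i t)%:E = 0.
    rewrite /l eqxx -[RHS]N0 -[in RHS](setIT N); exact: integral_indic.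
  by rewrite (bigD1 i)//= li0 mul0e.
- by move=> j; rewrite /l; case: ifPn => // _; exact: measurable_indic.
- by move=> j t; rewrite /l; case: ifPn.
Qed.

(** Between completed sigma-algebras Borel measurability does not suffice: the coordinate map must
    also pull null sets back to null sets, which is [leb_tnth_null]. *)
Lemma measurable_rspace_tnth n (i : 'I_n) :
  measurable_fun setT (fun x : rspace R n => tnth x i : lreal R).
Proof.
move=> _ A mA; rewrite setTI; have [N [mN N0 mAN]] := lreal_borel A mA.
have mi := @measurable_tnth _ RT n i.
have mpre (B : set RT) : measurable B ->
    measurable ((fun x : n.-tuple RT => tnth x i) @^-1` B).
  by move=> mB; have := mi measurableT _ mB; rewrite setTI.
apply: (completion_measurable_set _ (@measurable_rspace_id R n) _ _ (@lebnE R n)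
  (@lebn_complete R n) _ _ _ (mpre _ mAN) (mpre _ mN) (leb_tnth_null n i N mN N0)).
by move=> x /= nN; split => // -[].
Qed.

Context {d : nat} (X : 'I_d -> set R) (lam : 'I_d -> R -> R).
Hypotheses (mX : forall i, measurable (X i : set (lreal R)))
  (mlam : forall i, measurable_fun (X i : set (lreal R)) (lam i : lreal R -> R))
  (lam_ge0 : forall i t, X i t -> (0 <= lam i t)%R).

Lemma measurable_box : measurable (box X : set (rspace R d)).
Proof.
rewrite (_ : box X = \bigcap_(i in [set: 'I_d]) ((fun x => tnth x i) @^-1` X i)).
  apply: fin_bigcap_measurable => // i _.
  by have := measurable_rspace_tnth d i measurableT _ (mX i); rewrite setTI.
by apply/seteqP; split => [x Xx i _|x Xx i]; [exact: Xx|exact: (Xx i I)].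
Qed.

Lemma weight_ge0 x : box X x -> (0 <= weight lam x)%R.
Proof. by move=> Xx; apply: prodr_ge0 => i _; exact/lam_ge0/Xx. Qed.

(** The version is chosen factor by factor, so it remains a product and its integral splits over the
    coordinates. This ties [weight_mass], a product of integrals on the line, to an integral over
    the box. *)
Lemma weight_version : exists (w : d.-tuple RT -> R) (N : set (d.-tuple RT)),
  [/\ measurable_fun setT w, forall x, (0 <= w x)%R, measurable N /\ leb d N = 0,
     forall x, ~ N x -> (weight lam \_ (box X)) x = w x &
     \int[leb d]_x (w x)%:E = weight_mass X lam].
Proof.
have version i : exists N : set RT, [/\ measurable N, lebesgue_measure N = 0 &
    measurable_fun (~` N) (lam i \_ (X i))].
  apply: borel_version => r.
  apply: (lreal_borel [set t | (r < (lam i \_ (X i)) t)%R]).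
  have mp : measurable_fun setT (lam i \_ (X i) : lreal R -> R).
    by apply/measurable_restrict => //; rewrite setTI.
  have := mp measurableT _ (measurable_itv `]r, +oo[); rewrite setTI.
  by congr measurable; apply/seteqP; split => t /=; rewrite in_itv/= andbT.
have [N /all_and3[mN N0 mlN]] := choice version.
pose l i : RT -> R := (lam i \_ (X i)) \_ (~` N i).
have ml i : measurable_fun setT (l i).
  by apply/measurable_restrict => //; [exact: measurableC|rewrite setTI].
have p0 i t : (0 <= (lam i \_ (X i)) t)%R.
  by rewrite /patch; case: ifPn => // /set_mem; exact: lam_ge0.
have l0 i t : (0 <= l i t)%R by rewrite /l {1}/patch; case: ifPn.
have lE i t : ~ N i t -> (lam i \_ (X i)) t = l i t.
  by move=> nN; rewrite /l [RHS]patchE mem_set.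
exists (fun x => \prod_(i < d) l i (tnth x i))%R.
exists (\big[setU/set0]_(i < d) ((fun x : d.-tuple RT => tnth x i) @^-1` N i)).
have mpre i : measurable ((fun x : d.-tuple RT => tnth x i) @^-1` N i).
  by have := @measurable_tnth _ RT d i measurableT _ (mN i); rewrite setTI.
split.
- apply: measurable_prod => i _.
  exact: measurableT_comp (ml i) (@measurable_tnth _ RT d i).
- by move=> x; apply: prodr_ge0.
- split; first exact: bigsetU_measurable.
  apply/negligibleP; first exact: bigsetU_measurable.
  apply: (big_ind (fun A => (leb d).-negligible A)).
  + exact: negligible_set0.
  + by move=> A B; exact: negligibleU.
  + by move=> i _; apply/negligibleP => //; exact: leb_tnth_null.
- move=> x nN; have nNi i : ~ N i (tnth x i).
    by move=> Ni; apply: nN; rewrite (bigD1 i)//=; left.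
  rewrite /patch; case: ifPn => [/set_mem Xx|Xx].
    by apply: eq_bigr => i _; rewrite -lE// patchE mem_set//; exact: Xx.
  have [i nXi] : exists i, ~ X i (tnth x i).
    by apply/existsNP => Xx'; move: Xx; rewrite mem_set.
  by rewrite (bigD1 i)//= -lE// patchE memNset// mul0r.
- rewrite leb_integral_prod// /weight_mass; apply: eq_bigr => i _.
  rewrite [RHS]integral_mkcond; apply/esym.
  transitivity (\int[completed_lebesgue_measure]_t ((lam i \_ (X i)) t)%:E).
    by apply: eq_integral => t _; rewrite /patch; case: ifPn.
  apply: (completion_integral _ measurable_lreal_id _ _ completed_lebesgue_measureE
    completed_lebesgue_measure_is_complete _ _ (N i)) => //.
  + exact/measurable_EFinP.
  + by move=> t; rewrite lee_fin.
  + by move=> t; rewrite lee_fin.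
  + exact: N0.
  + by move=> t nN; rewrite /= lE.
Qed.

End weight_measurability.

(** * Weighted integrals and norms over the box *)

Section weighted_norms.
Context {R : realType} {d : nat} (X : 'I_d -> set R) (lam : 'I_d -> R -> R).
Hypotheses (mX : forall i, measurable (X i : set (lreal R)))
  (mlam : forall i, measurable_fun (X i : set (lreal R)) (lam i : lreal R -> R))
  (lam_ge0 : forall i t, X i t -> 0 <= lam i t).

Lemma measurable_weight : measurable_fun (box X : set (rspace R d)) (weight lam).
Proof.
have [w [N [mw w0 [mN N0] wE _]]] := weight_version X lam mX mlam lam_ge0.
apply/(measurable_restrictT _ (measurable_box X mX))/measurable_EFinP.
apply: (completion_measurable_fun _ (@measurable_rspace_id R d) _ _ (@lebnE R d)
  (@lebn_complete R d) _ (fun x => (w x)%:E) _ _ mN N0).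
  exact/measurable_EFinP.
by move=> x nN; rewrite /= wE.
Qed.

Lemma wint1 : wint X lam (fun=> 1) = weight_mass X lam.
Proof.
have [w [N [mw w0 [mN N0] wE <-]]] := weight_version X lam mX mlam lam_ge0.
rewrite /wint integral_mkcond.
transitivity (\int[lebn d]_x (((weight lam) \_ (box X)) x)%:E)%E.
  by apply: eq_integral => x _; rewrite /patch; case: ifPn; rewrite ?mul1r.
apply: (completion_integral _ (@measurable_rspace_id R d) _ _ (@lebnE R d)
  (@lebn_complete R d) _ _ N) => //.
- exact/measurable_EFinP.
- by move=> x; rewrite lee_fin /patch; case: ifPn => // /set_mem; exact: weight_ge0.
- by move=> x nN; rewrite /= wE.
Qed.

Lemma wint_ge0 f : (forall x, box X x -> 0 <= f x) -> (0 <= wint X lam f)%E.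
Proof.
move=> f0; apply: integral_ge0 => x Xx.
by rewrite lee_fin mulr_ge0 ?f0//; exact: weight_ge0 Xx.
Qed.

Lemma wint_integrable (f : rspace R d -> R) :
  measurable_fun (box X : set (rspace R d)) f ->
  (forall x, box X x -> 0 <= f x) -> (wint X lam f < +oo)%E ->
  (lebn d).-integrable (box X) (EFin \o (fun x => f x * weight lam x)).
Proof.
move=> mf f0 foo; apply/integrableP; split.
  by apply/measurable_EFinP/measurable_funM => //; exact: measurable_weight.
apply: le_lt_trans foo; rewrite le_eqVlt; apply/orP; left; apply/eqP.
apply: eq_integral => x /set_mem Xx; rewrite gee0_abs// lee_fin mulr_ge0 ?f0//.
exact: weight_ge0 Xx.
Qed.

Lemma Lnormw1 f : (forall x, box X x -> 0 <= f x) ->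
  Lnormw X lam 1 f = wint X lam f.
Proof.
move=> f0; rewrite /Lnormw invr1 poweRe1; last by apply: wint_ge0 => x _; exact: powR_ge0.
by apply: eq_integral => x /set_mem Xx; rewrite powRr1// ger0_norm// f0.
Qed.

Lemma Lnormw2 f : Lnormw X lam 2 f = (wint X lam (fun x => (f x ^+ 2)%R) `^ 2^-1)%E.
Proof.
congr (_ `^ _)%E; apply: eq_integral => x _.
by rewrite powR_mulrn// real_normK// num_real.
Qed.

Lemma Lnormw2_lty f : (Lnormw X lam 2 f < +oo)%E ->
  (wint X lam (fun x => (f x ^+ 2)%R) < +oo)%E.
Proof.
rewrite Lnormw2 !ltey; apply: contra => /eqP ->.
by rewrite /= invr_eq0 pnatr_eq0.
Qed.

Lemma Lnormw2_sqrt f : (Lnormw X lam 2 f < +oo)%E ->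
  Lnormw X lam 2 f = (Num.sqrt (fine (wint X lam (fun x => (f x ^+ 2)%R))))%:E.
Proof.
move=> foo; have f0 : (0 <= wint X lam (fun x => (f x ^+ 2)%R))%E.
  by apply: wint_ge0 => x _; exact: sqr_ge0.
have ffin : wint X lam (fun x => (f x ^+ 2)%R) \is a fin_num.
  by rewrite ge0_fin_numE//; exact: Lnormw2_lty.
by rewrite Lnormw2 -[in LHS](fineK ffin) poweR_EFin powR12_sqrt// fine_ge0.
Qed.

End weighted_norms.

Section rspace_functions.
Context {R : realType}.
Local Notation RT := (measurableTypeR R).

Lemma rspace_borel_version n (f : rspace R n -> R) : measurable_fun setT f ->
  exists N : set (n.-tuple RT), [/\ measurable N, leb n N = 0%E &
    measurable_fun setT (f \_ (~` N) : n.-tuple RT -> R)].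
Proof.
move=> mf; have [|N [mN N0 mfN]] := borel_version (leb n) f.
  move=> r; apply: (caratheodory_borel (leb n) _ (sigma_finiteT (leb n))).
  have := mf measurableT _ (measurable_itv `]r, +oo[); rewrite setTI.
  by congr measurable; apply/seteqP; split => t /=; rewrite in_itv/= andbT.
exists N; split => //.
by apply/(measurable_restrictT _ (measurableC mN)).
Qed.

Lemma integral_Rintegral {d} {T : measurableType d}
    (m : {measure set T -> \bar R}) (D : set T) (f : T -> R) : measurable D ->
  m.-integrable D (EFin \o f) ->
  (\int[m]_(x in D) (f x)%:E)%E = (\int[m]_(x in D) f x)%:E.
Proof. by move=> mD fi; rewrite /Rintegral fineK//; exact: integrable_fin_num. Qed.

End rspace_functions.

(** * Pointwise algebra of the two densities *)

Section integrands.
Context {R : realFieldType}.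
Implicit Types a b z w M : R.

(** With [a = pi] and [b = pihat] the left side is the divergence integrand. At a zero of the weight
    both sides are 0, by [x / 0 = 0]. *)
Lemma chi2_integrand a b z zh w : 0 < b -> 0 < z -> 0 < zh ->
  (z^-1 * (a * w) / (zh^-1 * (b * w))) ^+ 2 * (zh^-1 * (b * w)) =
  zh / z ^+ 2 * (a / b * a * w).
Proof.
move=> b0 z0 zh0; have [->|w0] := eqVneq w 0; first by rewrite !mulr0.
by field; rewrite w0 !gt_eqF.
Qed.

(** Applied with [c = a] under the target law and with [c = b] under the approximation. *)
Lemma ratio2_integrand a b c z w : 0 < b ->
  a ^+ 2 / b ^+ 2 * (z^-1 * (c * w)) = z^-1 * ((a / b) ^+ 2 * c * w).
Proof.
move=> b0; rewrite mulrCA; congr (_ * _).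
by field; rewrite gt_eqF.
Qed.

Lemma scaled_ratio_le a b z zh w M : 0 < b -> 0 < z -> 0 < zh -> 0 <= w ->
  a / b <= M -> z^-1 * (a * w) <= z^-1 * M * zh * (zh^-1 * (b * w)).
Proof.
move=> b0 z0 zh0 w0; rewrite ler_pdivrMr// => ab.
rewrite -(mulrA _ zh) mulVKf ?gt_eqF// -mulrA ler_pM2l ?invr_gt0//.
by rewrite mulrA ler_wpM2r.
Qed.

End integrands.

(** * The chi-square divergence *)

Section chi2_bound.
Context {R : realType}.

(** Cauchy-Schwarz in parametric form, so that only linearity and monotonicity of the integral are
    called for. The optimal [k] is [sqrt N / sqrt H]; if [H] or [N] is 0, a [k] scaled by [S]
    contradicts [S > 0]. *)
Lemma le_sqrtM_of_amgm (S H N : R) : 0 <= H -> 0 <= N ->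
  (forall k, 0 < k -> 2 * S <= k * H + k^-1 * N) ->
  S <= Num.sqrt H * Num.sqrt N.
Proof.
move=> H0 N0 HN; have [HN0|HN0] := leP (H * N) 0.
  suff S0 : S <= 0 by rewrite (le_trans S0)// mulr_ge0// sqrtr_ge0.
  rewrite leNgt; apply/negP => S0.
  have /eqP : H * N = 0 by apply/eqP; rewrite eq_le HN0 mulr_ge0.
  rewrite mulf_eq0 => /orP[/eqP Hz|/eqP Nz].
    have k0 : 0 < (N + 1) / S by rewrite divr_gt0// ltr_wpDl.
    have := HN _ k0; rewrite Hz mulr0 add0r invf_div mulrAC ler_pdivlMr.
      by nra.
    by rewrite ltr_wpDl.
  have k0 : 0 < S / (H + 1) by rewrite divr_gt0// ltr_wpDl.
  have := HN _ k0; rewrite Nz mulr0 addr0 mulrAC ler_pdivlMr; first by nra.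
  by rewrite ltr_wpDl.
have Hgt : 0 < H by nra.
have Ngt : 0 < N by nra.
have sH : 0 < Num.sqrt H by rewrite sqrtr_gt0.
have sN : 0 < Num.sqrt N by rewrite sqrtr_gt0.
have := HN _ (divr_gt0 sN sH).
rewrite -[X in _ <= _ * X + _](sqr_sqrtr H0) -[X in _ <= _ + _ * X](sqr_sqrtr N0).
rewrite (_ : _ + _ = 2 * (Num.sqrt H * Num.sqrt N)) ?ler_pM2l//.
by field; rewrite !gt_eqF.
Qed.

(** With [A], [B] the norms of two roots and [e] their squared distance, this is the factor 4 that a
    triangle inequality would lose on normalising. For [A <= 4 B] it is immediate; for [A > 4 B] it
    comes from [e <= A^2 + B^2], that is, from a nonnegative inner product. *)
Lemma hellinger_arith (A B e E : R) : 0 < A -> 0 < B -> 0 <= e ->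
  e <= A ^+ 2 + B ^+ 2 -> e <= 2 * E -> (e - (A - B) ^+ 2) * A <= 8 * E * B.
Proof.
move=> A0 B0 e0 eAB eE; apply: (@le_trans _ _ (4 * e * B)); last by nra.
have [AB4|AB4] := leP A (4 * B).
  rewrite -subr_ge0 (_ : _ - _ = e * (4 * B - A) + (A - B) ^+ 2 * A); last by ring.
  by rewrite addr_ge0// mulr_ge0 ?sqr_ge0 ?subr_ge0// ltW.
suff : e * (A - 4 * B) <= A * (A - B) ^+ 2 by lra.
apply: (@le_trans _ _ ((A ^+ 2 + B ^+ 2) * (A - 4 * B))).
  by rewrite ler_wpM2r// subr_ge0 ltW.
have : 0 <= A * B * (A + A) by rewrite !mulr_ge0// ?addr_ge0// ltW.
have : 0 <= B ^+ 3 by rewrite exprn_ge0// ltW.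
by lra.
Qed.

Context {d} {T : measurableType d} (m : {measure set T -> \bar R}) (D : set T)
  (mD : measurable D) (W : T -> R).
Hypotheses (mW : measurable_fun D W) (W0 : forall x, D x -> 0 <= W x).

Let int (f : T -> R) := m.-integrable D (EFin \o (fun x => f x * W x)).
Let I (f : T -> R) := \int[m]_(x in D) (f x * W x).

Let int_lin r s f g : int f -> int g -> int (fun x => r * f x + s * g x).
Proof.
move=> fi gi; have := integrableD mD (integrableZl mD r fi) (integrableZl mD s gi).
by apply: eq_integrable => // x _; rewrite /= -!EFinM -EFinD mulrDl !mulrA.
Qed.

Let I_lin r s f g : int f -> int g ->
  I (fun x => r * f x + s * g x) = r * I f + s * I g.
Proof.
move=> fi gi; rewrite /I -!RintegralZl// -RintegralD//.
- by apply: eq_Rintegral => x _; rewrite mulrDl !mulrA.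
- by apply: eq_integrable (integrableZl mD r fi) => // x _; rewrite /= EFinM.
- by apply: eq_integrable (integrableZl mD s gi) => // x _; rewrite /= EFinM.
Qed.

Let I_eq f g : (forall x, D x -> f x = g x) -> I f = I g.
Proof. by move=> fg; apply: eq_Rintegral => x /set_mem Dx; rewrite fg. Qed.

Let int_eq f g : (forall x, D x -> f x = g x) -> int f -> int g.
Proof.
by move=> fg; apply: eq_integrable => // x /set_mem Dx; rewrite /= fg.
Qed.

Let I_le (f g : T -> R) : int f -> int g -> (forall x, D x -> f x <= g x) -> I f <= I g.
Proof.
by move=> fi gi fg; apply: le_Rintegral => // x Dx; rewrite ler_wpM2r ?W0 ?fg.
Qed.

Let I_ge0 (f : T -> R) : (forall x, D x -> 0 <= f x) -> 0 <= I f.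
Proof. by move=> f0; apply: Rintegral_ge0 => x Dx; rewrite mulr_ge0 ?f0 ?W0. Qed.

Let int_dom (f g : T -> R) : measurable_fun D f -> (forall x, D x -> 0 <= f x <= g x) ->
  int g -> int f.
Proof.
move=> mf fg; apply: le_integrable => //.
  by apply/measurable_EFinP/measurable_funM.
move=> x Dx; have /andP[f0 fgx] := fg x Dx.
rewrite /= lee_fin !normrM ler_wpM2r// !ger0_norm//.
exact: le_trans fgx.
Qed.

Context (a g : T -> R) (gamma eps M : R).
Hypotheses (ma : measurable_fun D a) (mg : measurable_fun D g)
  (a0 : forall x, D x -> 0 <= a x) (gamma0 : 0 < gamma) (eps0 : 0 <= eps).

Let ph x : R := gamma + g x ^+ 2.
Let s x : R := Num.sqrt (a x).
Let t x : R := Num.sqrt (ph x).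

Hypotheses (i1 : int (fun=> 1)) (ia : int a) (ig : int (fun x => g x ^+ 2)).
Hypothesis ie : int (fun x => (g x - s x) ^+ 2).
Hypothesis ratioM : forall x, D x -> a x / ph x <= M.
Hypotheses (z0 : 0 < I a) (e_eps : I (fun x => (g x - s x) ^+ 2) <= eps ^+ 2)
  (gamma_e : gamma * I (fun=> 1) <= I (fun x => (g x - s x) ^+ 2)).

Let ph_gt0 x : 0 < ph x.
Proof. by rewrite /ph ltr_wpDr// sqr_ge0. Qed.

Let mph : measurable_fun D ph.
Proof. by apply: measurable_funD => //; exact: measurable_funX. Qed.

Let msqrt (f : T -> R) : measurable_fun D f -> measurable_fun D (fun x => Num.sqrt (f x)).
Proof.
move=> mf; apply: measurableT_comp mf.
by apply: continuous_measurable_fun; exact: sqrt_continuous.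
Qed.

Let minvph : measurable_fun D (fun x => (ph x)^-1).
Proof. exact: measurable_funV. Qed.

Lemma integrable_approx : int ph.
Proof.
by apply: int_eq (int_lin gamma 1 _ _ i1 ig) => x _; rewrite mulr1 mul1r.
Qed.
Let iph := integrable_approx.

Lemma integral_approx : I ph = gamma * I (fun=> 1) + I (fun x => g x ^+ 2).
Proof.
rewrite -[I (fun x => g x ^+ 2)]mul1r -(I_lin _ _ _ _ i1 ig).
by apply: I_eq => x _; rewrite mulr1 mul1r.
Qed.

Let ist : int (fun x => s x * t x).
Proof.
apply: (int_dom _ (fun x => 2^-1 * a x + 2^-1 * ph x)); last exact: int_lin.
  by apply: measurable_funM; exact: msqrt.
move=> x Dx; rewrite mulr_ge0 ?sqrtr_ge0//=.
have := sqr_ge0 (s x - t x).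
rewrite -[in a x](sqr_sqrtr (a0 x Dx)) -[X in _ + _ * X](sqr_sqrtr (ltW (ph_gt0 x))).
by rewrite -/(s x) -/(t x); nra.
Qed.

Let sE x : D x -> s x ^+ 2 = a x. Proof. by move=> Dx; rewrite sqr_sqrtr ?a0. Qed.
Let tE x : t x ^+ 2 = ph x. Proof. by rewrite sqr_sqrtr// ltW. Qed.
Let s0 x : 0 <= s x. Proof. exact: sqrtr_ge0. Qed.
Let t0 x : 0 < t x. Proof. by rewrite sqrtr_gt0. Qed.

Let rho x : R := a x / ph x.

Let rho0 x : D x -> 0 <= rho x.
Proof. by move=> Dx; rewrite divr_ge0 ?a0// ltW. Qed.

Let mrho : measurable_fun D rho. Proof. exact: measurable_funM. Qed.

Let Mrho x : D x -> rho x <= `|M|.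
Proof. by move=> Dx; rewrite (le_trans (ratioM x Dx))// ler_norm. Qed.

Let iM (f h : T -> R) : measurable_fun D h ->
  (forall x, D x -> 0 <= h x <= `|M|) -> measurable_fun D f ->
  (forall x, D x -> 0 <= f x) -> int f -> int (fun x => h x * f x).
Proof.
move=> mh hM mf f0 fi; apply: (int_dom _ (fun x => `|M| * f x + 0 * f x)).
- exact: measurable_funM.
- move=> x Dx; have /andP[h0 hM'] := hM x Dx.
  by rewrite mulr_ge0 ?f0//= mul0r addr0 ler_wpM2r ?f0.
- exact: int_lin.
Qed.

Let rho_bnd x : D x -> 0 <= rho x <= `|M|.
Proof. by move=> Dx; rewrite rho0 ?Mrho. Qed.

Lemma integrable_ratio_target : int (fun x => rho x * a x). Proof. exact: iM. Qed.
Let ira := integrable_ratio_target.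

Let irra : int (fun x => rho x * (rho x * a x)).
Proof.
apply: iM => //; first exact: measurable_funM.
by move=> x Dx; rewrite mulr_ge0 ?rho0 ?a0.
Qed.

Let irst : int (fun x => rho x * (s x * t x)).
Proof.
apply: iM => //; first by apply: measurable_funM; exact: msqrt.
by move=> x Dx; rewrite mulr_ge0// ltW.
Qed.

Let z := I a.
Let zh := I ph.

Lemma approx_integral_gt0 : 0 < zh.
Proof.
(* This integrates [a <= |M| ph]; with [z > 0] it excludes [zh = 0]. The vanishing second term fits
   the two-term shape of [I_lin]. *)
have zzh : z <= `|M| * zh + 0 * zh.
  rewrite -I_lin//; apply: I_le => //; first exact: int_lin.
  move=> x Dx; rewrite mul0r addr0 -ler_pdivrMr//; exact: Mrho.
have : 0 <= zh by apply: I_ge0 => x _; exact: ltW.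
by have := normr_ge0 M; have : 0 < z by []; nra.
Qed.
Let zh0 := approx_integral_gt0.

Let A := Num.sqrt z.
Let B := Num.sqrt zh.
Let A0 : 0 < A. Proof. by rewrite sqrtr_gt0. Qed.
Let B0 : 0 < B. Proof. by rewrite sqrtr_gt0. Qed.
Let AE : A ^+ 2 = z. Proof. by rewrite sqr_sqrtr// ltW. Qed.
Let BE : B ^+ 2 = zh. Proof. by rewrite sqr_sqrtr// ltW. Qed.

Let c := I (fun x => s x * t x).
(* Twice the squared Hellinger distance between [a / z] and [ph / zh]. *)
Let H := 2 - 2 * c / (A * B).

Let iH : int (fun x => (s x / A - t x / B) ^+ 2).
Proof.
have := int_lin 1 (- (2 / (A * B))) _ _ (int_lin z^-1 zh^-1 _ _ ia iph) ist.
apply: int_eq => x Dx; rewrite -(sE x Dx) -tE -AE -BE.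
by field; rewrite !gt_eqF.
Qed.

Let HE : I (fun x => (s x / A - t x / B) ^+ 2) = H.
Proof.
transitivity (I (fun x => 1 * (z^-1 * a x + zh^-1 * ph x) + - (2 / (A * B)) * (s x * t x))).
  apply: I_eq => x Dx; rewrite -(sE x Dx) -tE -AE -BE.
  by field; rewrite !gt_eqF.
rewrite !I_lin//; last exact: int_lin.
rewrite -/z -/zh -/c !mulVf ?gt_eqF// /H; ring.
Qed.

Let c0 : 0 <= c.
Proof. by apply: I_ge0 => x _; rewrite mulr_ge0// ltW. Qed.

Let ie2 : int (fun x => (s x - t x) ^+ 2).
Proof.
have := int_lin 1 (- 2) _ _ (int_lin 1 1 _ _ ia iph) ist.
by apply: int_eq => x Dx; rewrite -(sE x Dx) -tE; ring.
Qed.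

Let e2E : I (fun x => (s x - t x) ^+ 2) = z + zh - 2 * c.
Proof.
transitivity (I (fun x => 1 * (1 * a x + 1 * ph x) + - 2 * (s x * t x))).
  by apply: I_eq => x Dx; rewrite -(sE x Dx) -tE; ring.
by rewrite !I_lin//; [rewrite -/z -/zh -/c; ring|exact: int_lin].
Qed.

Let e2_le : z + zh - 2 * c <= 2 * eps ^+ 2.
Proof.
rewrite -e2E.
have : I (fun x => (s x - t x) ^+ 2) <=
    I (fun x => gamma * 1 + 1 * (g x - s x) ^+ 2).
  apply: I_le => //; first exact: int_lin.
  (* After expansion the inequality reduces to [s g <= s t], and [g <= |g| <= t]. Of the final
     [2 eps^2], one half comes from [gamma] and one from the distance of [g] to [s]. *)
  move=> x Dx; have gt : g x <= t x.
    by rewrite (le_trans (ler_norm _))// -sqrtr_sqr ler_wsqrtr// /ph lerDr ltW.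
  have := ler_wpM2l (s0 x) gt.
  have := tE x; rewrite /ph => t2; rewrite !sqrrB t2; nra.
rewrite I_lin// mul1r => /le_trans; apply.
by rewrite mulr_natl mulr2n lerD// (le_trans gamma_e).
Qed.

(** The squared distance [e] of the unnormalised roots splits as the square of [A - B] plus [A B H],
    so [H] is controlled through [hellinger_arith]. *)
Let H_le : H <= 8 * eps ^+ 2 / z.
Proof.
have AB : 0 < A * B by rewrite mulr_gt0.
rewrite ler_pdivlMr// /H -AE.
have -> : (2 - 2 * c / (A * B)) * A ^+ 2 = (2 * (A * B) - 2 * c) * A / B.
  by field; rewrite !gt_eqF.
rewrite ler_pdivrMr//.
have := e2_le; rewrite -AE -BE => e2.
set e := A ^+ 2 + B ^+ 2 - 2 * c in e2.
have e_le : e <= A ^+ 2 + B ^+ 2 by rewrite /e lerBlDr lerDl mulr_ge0.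
have e_ge : 0 <= e.
  by rewrite /e AE BE -e2E; apply: I_ge0 => x _; exact: sqr_ge0.
have -> : 2 * (A * B) - 2 * c = e - (A - B) ^+ 2 by rewrite /e; ring.
exact: hellinger_arith.
Qed.

Let N1 := I (fun x => rho x ^+ 2 * a x).
Let N2 := I (fun x => rho x ^+ 2 * ph x).

Lemma integrable_ratio2_target : int (fun x => rho x ^+ 2 * a x).
Proof. by apply: int_eq irra => x _; rewrite mulrA. Qed.
Let iN1 := integrable_ratio2_target.

Lemma integrable_ratio2_approx : int (fun x => rho x ^+ 2 * ph x).
Proof.
apply: int_eq ira => x Dx; rewrite expr2 -mulrA; congr (_ * _).
by rewrite /rho divfK// gt_eqF.
Qed.
Let iN2 := integrable_ratio2_approx.

(* [rho (p - q) = rho (sqrt p - sqrt q) (sqrt p + sqrt q)] with [p = a / z] and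
   [q = ph / zh]; [S1_le] and [S2_le] are Cauchy-Schwarz for its two summands. *)
Let S1_le : I (fun x => rho x * a x) / z - I (fun x => rho x * (s x * t x)) / (A * B) <=
  Num.sqrt H * Num.sqrt (N1 / z).
Proof.
apply: le_sqrtM_of_amgm.
- by rewrite -HE; apply: I_ge0 => x _; exact: sqr_ge0.
- apply: divr_ge0; last exact: ltW.
  by apply: I_ge0 => x Dx; rewrite mulr_ge0 ?sqr_ge0 ?a0.
move=> k k0.
have -> : 2 * (I (fun x => rho x * a x) / z -
    I (fun x => rho x * (s x * t x)) / (A * B)) =
    I (fun x => (2 / z) * (rho x * a x) + (- (2 / (A * B))) * (rho x * (s x * t x))).
  by rewrite I_lin//; field; rewrite !gt_eqF.
have -> : k * H + k^-1 * (N1 / z) =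
    I (fun x => k * (s x / A - t x / B) ^+ 2 + (k^-1 / z) * (rho x ^+ 2 * a x)).
  by rewrite I_lin// HE -/N1; ring.
apply: I_le; [exact: int_lin|exact: int_lin|] => x Dx.
rewrite -(sE x Dx) -AE -subr_ge0.
(* The difference is a perfect square: weighted AM-GM for the factors [s / A - t / B] and
   [rho s / A]. *)
rewrite (_ : _ - _ = k * (s x / A - t x / B - k^-1 * (rho x * s x / A)) ^+ 2).
  by rewrite mulr_ge0 ?sqr_ge0// ltW.
by field; rewrite !gt_eqF.
Qed.

Let S2_le : I (fun x => rho x * (s x * t x)) / (A * B) - z / zh <=
  Num.sqrt H * Num.sqrt (N2 / zh).
Proof.
apply: le_sqrtM_of_amgm.
- by rewrite -HE; apply: I_ge0 => x _; exact: sqr_ge0.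
- apply: divr_ge0; last exact: ltW.
  by apply: I_ge0 => x Dx; rewrite mulr_ge0 ?sqr_ge0// ltW.
move=> k k0.
have -> : 2 * (I (fun x => rho x * (s x * t x)) / (A * B) - z / zh) =
    I (fun x => (2 / (A * B)) * (rho x * (s x * t x)) + (- (2 / zh)) * a x).
  by rewrite I_lin// -/z; field; rewrite !gt_eqF.
have -> : k * H + k^-1 * (N2 / zh) =
    I (fun x => k * (s x / A - t x / B) ^+ 2 + (k^-1 / zh) * (rho x ^+ 2 * ph x)).
  by rewrite I_lin// HE -/N2; ring.
apply: I_le; [exact: int_lin|exact: int_lin|] => x Dx.
have -> : a x = rho x * ph x by rewrite /rho divfK// gt_eqF.
rewrite -tE -BE -subr_ge0.
rewrite (_ : _ - _ = k * (s x / A - t x / B - k^-1 * (rho x * t x / B)) ^+ 2).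
  by rewrite mulr_ge0 ?sqr_ge0// ltW.
by field; rewrite !gt_eqF.
Qed.

Lemma chi2_bound : zh / z ^+ 2 * I (fun x => rho x * a x) - 1 <=
  (Num.sqrt (N1 / z) + Num.sqrt (N2 / zh)) *
  (2 * Num.sqrt 2 * zh / (z * Num.sqrt z) * eps).
Proof.
have sH : Num.sqrt H <= 2 * Num.sqrt 2 * eps / A.
  rewrite -(@ler_pXn2r _ 2)// ?nnegrE ?sqrtr_ge0//; last first.
    by rewrite divr_ge0 ?mulr_ge0// ltW.
  rewrite sqr_sqrtr; last by rewrite -HE; apply: I_ge0 => x _; exact: sqr_ge0.
  apply: le_trans H_le _; rewrite -AE le_eqVlt; apply/orP; left; apply/eqP.
  transitivity (2 ^+ 2 * Num.sqrt 2 ^+ 2 * eps ^+ 2 / A ^+ 2).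
    by rewrite sqr_sqrtr//; field; rewrite gt_eqF.
  by field; rewrite gt_eqF.
(* The mixed integral of [rho s t] is subtracted and added. The term [z / zh] is the integral of
   [rho] against the approximation, because [rho * ph = a]. *)
have -> : zh / z ^+ 2 * I (fun x => rho x * a x) - 1 =
  zh / z * ((I (fun x => rho x * a x) / z - I (fun x => rho x * (s x * t x)) / (A * B)) +
    (I (fun x => rho x * (s x * t x)) / (A * B) - z / zh)).
  by field; rewrite !gt_eqF.
have -> : 2 * Num.sqrt 2 * zh / (z * Num.sqrt z) * eps =
    zh / z * (2 * Num.sqrt 2 * eps / A).
  by rewrite -/A; field; rewrite !gt_eqF.
rewrite mulrCA ler_pM2l; last by rewrite divr_gt0.
apply: (@le_trans _ _ (Num.sqrt H * (Num.sqrt (N1 / z) + Num.sqrt (N2 / zh)))).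
  by rewrite mulrDr lerD.
by rewrite [leRHS]mulrC ler_wpM2r// addr_ge0 ?sqrtr_ge0.
Qed.

End chi2_bound.

(** * Lebesgue densities and the divergence computed from them *)

Section densities.
Context {R : realType}.

Local Open Scope ereal_scope.

Lemma density_ae n (nu : probability (rspace R n) R) (p : rspace R n -> R) :
  is_density nu p -> ae_eq (@lebn R n) setT (density nu) p.
Proof.
move=> dp; have [mq q0 qE] : is_density nu (density nu).
  by apply: (@xgetPex _ (cst 0%R) [set p | is_density nu p]); exists p.
have [mp p0 pE] := dp.
have : ae_eq (@lebn R n) setT (EFin \o density nu) (EFin \o p).
  apply: (integral_ae_eq measurableT).
  - apply/integrableP; split; first exact/measurable_EFinP.
    rewrite (eq_integral (fun x => (density nu x)%:E)); last first.
      by move=> x _; rewrite gee0_abs// lee_fin.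
    rewrite -(qE _ measurableT).
    exact: (le_lt_trans (probability_le1 nu measurableT) (ltry _)).
  - exact/measurable_EFinP.
  - by move=> E _ mE; rewrite /= -(qE _ mE) -(pE _ mE).
by apply: filterS => x H /H [].
Qed.

Lemma integral_density n (nu : {measure set (rspace R n) -> \bar R})
    (p f : rspace R n -> R) (D : set (rspace R n)) :
  is_density nu p -> measurable D -> measurable_fun D f ->
  (forall x, D x -> (0 <= f x)%R) ->
  \int[nu]_(x in D) (f x)%:E = \int[lebn n]_(x in D) (f x * p x)%:E.
Proof.
move=> [mp p0 pE] mD mf f0; rewrite integral_mkcond.
have mfD : measurable_fun setT ((fun x => (f x)%:E) \_ D).
  by apply/(measurable_restrictT _ mD)/measurable_EFinP.
have fD0 x : 0 <= ((fun x => (f x)%:E) \_ D) x.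
  by rewrite /patch; case: ifPn => // /set_mem Dx; rewrite lee_fin f0.
have mEp : measurable_fun setT (fun x => (p x)%:E) by exact/measurable_EFinP.
have Ep0 x : 0 <= (p x)%:E by rewrite lee_fin.
rewrite (integral_weighted (lebn n) nu (fun x => (p x)%:E) mEp Ep0 pE _ mfD fD0).
rewrite [RHS]integral_mkcond; apply: eq_integral => x _; rewrite /patch.
by case: ifPn => // _; rewrite mul0e.
Qed.

Lemma density_dominates n (nu nu' : probability (rspace R n) R)
    (p p' : rspace R n -> R) (C : R) :
  is_density nu p -> is_density nu' p' -> (0 <= C)%R ->
  (forall x, (p x <= C * p' x)%R) -> nu `<< nu'.
Proof.
move=> [mp p0 pE] [mp' p'0 p'E] C0 pp'; apply/null_content_dominatesP => A mA A0.
suff le0 : \int[lebn n]_(x in A) (p x)%:E <= 0.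
  apply/eqP; rewrite eq_le measure_ge0 andbT.
  by apply: le_trans le0; rewrite -(pE _ mA).
have p'A := p'E _ mA; move: {pE p'E} p'A => p'A.
apply: (@le_trans _ _ (\int[lebn n]_(x in A) (C%:E * (p' x)%:E))).
  apply: ge0_le_integral.
  - exact: mA.
  - by move=> x _; rewrite lee_fin.
  - exact/measurable_EFinP/(measurable_funTS mp).
  - apply/measurable_EFinP; apply: measurable_funM; first exact: measurable_cst.
    exact: (measurable_funTS mp').
  - by move=> x _; rewrite -EFinM lee_fin.
rewrite (ge0_integralZl _ mA); first by rewrite -p'A A0 mule0.
- exact/measurable_EFinP/(measurable_funTS mp').
- by move=> x _; rewrite lee_fin.
- by rewrite lee_fin.
Qed.

(** [density] selects an arbitrary representative; by [density_ae] the selection affects the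
    integrand only on a null set, so explicit densities may replace it. *)
Lemma chi2_div_density n (nu nu' : probability (rspace R n) R)
    (p p' : rspace R n -> R) :
  is_density nu p -> is_density nu' p' -> nu `<< nu' ->
  chi2_div nu nu' = \int[lebn n]_x ((p x / p' x) ^+ 2 * p' x)%:E - 1.
Proof.
move=> dp dp' nunu'; rewrite /chi2_div; case: asboolP => // _.
have [mp _ _] := dp; have [mp' _ _] := dp'.
have [mq _ _] : is_density nu (density nu).
  by apply: (@xgetPex _ (cst 0%R) [set p | is_density nu p]); exists p.
have [mq' _ _] : is_density nu' (density nu').
  by apply: (@xgetPex _ (cst 0%R) [set p | is_density nu' p]); exists p'.
have mchi (f f' : rspace R n -> R) : measurable_fun setT f ->
    measurable_fun setT f' -> measurable_fun setT (fun x => ((f x / f' x) ^+ 2 * f' x)%:E).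
  move=> mf mf'; apply/measurable_EFinP; apply: (measurable_funM _ mf').
  apply: measurable_funX; apply: (measurable_funM mf).
  exact: (measurable_funV _ _ mf').
congr (_ - 1); apply: ae_eq_integral.
- exact: measurableT.
- exact: (mchi _ _ mq mq').
- exact: (mchi _ _ mp mp').
have := density_ae n nu p dp; have := density_ae n nu' p' dp'.
by apply: filterS2 => x H H' _; rewrite H// H'.
Qed.

End densities.

Theorem corollary2 (R : realType) (d : nat)
    (X : 'I_d -> set R) (lam : 'I_d -> R -> R)
    (mX : forall i, measurable (X i : set (lreal R)))
    (mlam : forall i,
       measurable_fun (X i : set (lreal R)) (lam i : lreal R -> R))
    (lam_ge0 : forall i t, X i t -> 0 <= lam i t)
    (mass_gt0 : (0 < weight_mass X lam)%E)
    (mass_fin : (weight_mass X lam < +oo)%E)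
    (target : d.-tuple R -> R)
    (target_ge0 : forall x, box X x -> 0 <= target x)
    (target_L1 : in_Lpw X lam 1 target)
    (z_gt0 : 0 < target_mass X lam target)
    (nu : probability (rspace R d) R)
    (nu_density : is_density nu (target_density X lam target))
    (g : d.-tuple R -> R)
    (g_L2 : in_Lpw X lam 2 g)
    (g_tt : tensor_train X g)
    (gamma : R) (gamma_gt0 : 0 < gamma)
    (T : {mfun rspace R d >-> rspace R d})
    (T_inverse : inverse_rosenblatt (box X) (approx_density X lam g gamma) T)
    (eps : R) (eps_ge0 : 0 <= eps)
    (g_eps :
       (Lnormw X lam 2 (fun x => (g x - Num.sqrt (target x))%R) <= eps%:E)%E)
    (gamma_le :
       (gamma%:E <= ((fine (weight_mass X lam))^-1)%:E *
          Lnormw X lam 2 (fun x => (g x - Num.sqrt (target x))%R) ^+ 2)%E)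
    (sup_ratio :
       (ereal_sup [set (target x / pihat g gamma x)%R%:E | x in box X]
          < +oo)%E) :
  let z := target_mass X lam target in
  let zhat := approx_mass X lam g gamma in
  let That_mu := distribution (@unif_cube R d) T in
  let ratio2 (x : rspace R d) := target x ^+ 2 / pihat g gamma x ^+ 2 in
  (chi2_div nu That_mu <=
   ((\int[nu]_(x in box X) (ratio2 x)%:E) `^ 2^-1 +
    (\int[That_mu]_(x in box X) (ratio2 x)%:E) `^ 2^-1) *
   (2 * Num.sqrt 2 * zhat / (z * Num.sqrt z) * eps)%R%:E)%E.
Proof.
cbv zeta.
set z := target_mass X lam target; set zhat := approx_mass X lam g gamma.
set That_mu := distribution (@unif_cube R d) T.
set D : set (rspace R d) := box X; set W : rspace R d -> R := weight lam.
pose m := @lebn R d.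
have mD : measurable D := measurable_box X mX.
have mW : measurable_fun D W := measurable_weight X lam mX mlam lam_ge0.
have W0 x : D x -> 0 <= W x := weight_ge0 X lam lam_ge0 x.
have [mt tL1] := target_L1; have [mg gL2] := g_L2.
pose e (x : rspace R d) := g x - Num.sqrt (target x).
have eoo : (Lnormw X lam 2 e < +oo)%E by exact: le_lt_trans g_eps (ltry _).
have me : measurable_fun D e.
  apply: (measurable_funB mg); apply: measurableT_comp mt.
  by apply: continuous_measurable_fun; exact: sqrt_continuous.
have int1 : m.-integrable D (EFin \o (fun x => 1 * W x)).
  apply: (wint_integrable X lam mX mlam lam_ge0 (fun=> 1)) => //.
  by rewrite (wint1 X lam mX mlam lam_ge0).
have intt : m.-integrable D (EFin \o (fun x => target x * W x)).
  apply: (wint_integrable X lam mX mlam lam_ge0 target mt) => //.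
  by rewrite -(Lnormw1 X lam lam_ge0).
have intg : m.-integrable D (EFin \o (fun x => g x ^+ 2 * W x)).
  apply: (wint_integrable X lam mX mlam lam_ge0 (fun x => g x ^+ 2)).
  - exact: measurable_funX.
  - by move=> x _; exact: sqr_ge0.
  - exact: (Lnormw2_lty X lam).
have inte : m.-integrable D (EFin \o (fun x => e x ^+ 2 * W x)).
  apply: (wint_integrable X lam mX mlam lam_ge0 (fun x => e x ^+ 2)).
  - exact: measurable_funX.
  - by move=> x _; exact: sqr_ge0.
  - exact: (Lnormw2_lty X lam).
pose I (f : rspace R d -> R) := \int[m]_(x in D) (f x * W x).
have Ie0 : 0 <= I (fun x => e x ^+ 2).
  by apply: Rintegral_ge0 => x Dx; rewrite mulr_ge0 ?sqr_ge0 ?W0.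
have sqrtIe := Lnormw2_sqrt X lam lam_ge0 e eoo.
have e_eps : I (fun x => e x ^+ 2) <= eps ^+ 2.
  move: g_eps; rewrite sqrtIe lee_fin => le_eps.
  by rewrite -(sqr_sqrtr Ie0) ler_pXn2r// nnegrE sqrtr_ge0.
have mass_fin' : weight_mass X lam \is a fin_num.
  by rewrite ge0_fin_numE// ltW.
have massE : I (fun=> 1) = fine (weight_mass X lam).
  by rewrite -(wint1 X lam mX mlam lam_ge0).
have gamma_e : gamma * I (fun=> 1) <= I (fun x => e x ^+ 2).
  move: gamma_le; rewrite sqrtIe -EFin_expe -EFinM lee_fin (sqr_sqrtr Ie0).
  by rewrite massE mulrC ler_pdivlMr ?fine_gt0 ?mass_gt0.
have [M ratioM] : exists M, forall x, D x -> target x / pihat g gamma x <= M.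
  (* The supremum is finite once the box has a point [x], whose ratio keeps it above [-oo]; then
     [fine] returns it unchanged. Over an empty box any [M] would do. *)
  exists (fine (ereal_sup [set (target x / pihat g gamma x)%R%:E | x in box X])).
  move=> x Dx; have ub : ((target x / pihat g gamma x)%:E <=
      ereal_sup [set (target x / pihat g gamma x)%R%:E | x in box X])%E.
    by apply: ereal_sup_ubound; exists x.
  rewrite -lee_fin fineK// fin_real// sup_ratio andbT.
  by apply: lt_le_trans ub; rewrite ltNyr.
have zE : z = I target by [].
have zhE : zhat = I (pihat g gamma).
  rewrite /zhat /approx_mass -massE.
  exact/esym/(integral_approx m D mD W g gamma int1 intg).
have zhat_gt0 : 0 < zhat.
  rewrite zhE; exact: (approx_integral_gt0 m D mD W W0 target g gamma M gamma_gt0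
    int1 intt intg ratioM z_gt0).
have ph_gt0 x : 0 < pihat g gamma x by rewrite /pihat ltr_wpDr// sqr_ge0.
have mph : measurable_fun D (pihat g gamma).
  by apply: measurable_funD; [exact: measurable_cst|exact: measurable_funX].
have intph : m.-integrable D (EFin \o (fun x => pihat g gamma x * W x)).
  exact: (integrable_approx m D mD W g gamma int1 intg).
have intra := integrable_ratio_target m D mD W mW target g gamma M mt mg
  target_ge0 gamma_gt0 intt ratioM.
have intrra := integrable_ratio2_target m D mD W mW target g gamma M mt mg
  target_ge0 gamma_gt0 intt ratioM.
have intrrp := integrable_ratio2_approx m D mD W mW target g gamma M mt mg
  target_ge0 gamma_gt0 intt ratioM.
have integral_scaled k (F : rspace R d -> R) :
    m.-integrable D (EFin \o (fun x => F x * W x)) ->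
    (\int[m]_(x in D) (k * (F x * W x))%:E = (k * I F)%:E)%E.
  move=> Fi; rewrite -(RintegralZl k mD Fi) -integral_Rintegral//.
  by apply: eq_integrable (integrableZl mD k Fi) => // x _; rewrite /= EFinM.
pose h : rspace R d -> R := approx_density X lam g gamma.
have h_ge0 x : 0 <= h x.
  rewrite /h /approx_density /patch; case: ifPn => // /set_mem Dx.
  by rewrite mulr_ge0 ?invr_ge0 ?(ltW zhat_gt0)// mulr_ge0 ?W0// ltW.
have mh : measurable_fun setT h.
  apply/(measurable_restrictT _ mD); apply: measurable_funM.
    exact: measurable_cst.
  exact: (measurable_funM mph mW).
have h_mass : (\int[m]_x (h x)%:E = 1)%E.
  transitivity (\int[m]_(x in D) (zhat^-1 * (pihat g gamma x * W x))%:E)%E.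
    rewrite [RHS]integral_mkcond; apply: eq_integral => x _.
    by rewrite /h /approx_density /patch; case: ifPn.
  by rewrite (integral_scaled _ _ intph) -zhE mulVf// gt_eqF.
have That_density : is_density That_mu h.
  (* [h] is only Lebesgue measurable; its Borel version is [h] set to 0 on a Borel null set. *)
  have [N [mN N0 mhN]] := rspace_borel_version d h mh.
  have hN0 x : 0 <= (h \_ (~` N)) x by rewrite /patch; case: ifPn.
  have hN x : ~ N x -> h x = (h \_ (~` N)) x by move=> nN; rewrite patchE mem_set.
  apply: (inverse_rosenblatt_density d (box X) h (h \_ (~` N)) N T h_ge0 mhN hN0
    mN N0 hN _ T_inverse).
  rewrite -h_mass; apply/esym.
  apply: (lebn_integral d setT N h (fun x => ((h \_ (~` N)) x)%:E) measurableT _ _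
    h_ge0 mN N0).
  - exact/measurable_EFinP.
  - by move=> x; rewrite lee_fin.
  - by move=> x nN; rewrite hN.
pose p : rspace R d -> R := target_density X lam target.
have M_ge0 : 0 <= `|M| by [].
have dom : nu `<< That_mu.
  (* The constant integrates nothing: it is the pointwise bound [pi <= |M| pihat] with both
     normalisations inserted, the absolute value keeping it nonnegative. *)
  apply: (density_dominates d nu That_mu p h (z^-1 * `|M| * zhat) nu_density That_density).
    have zV_ge0 : 0 <= z^-1 by rewrite invr_ge0 (ltW z_gt0).
    exact: (mulr_ge0 (mulr_ge0 zV_ge0 M_ge0) (ltW zhat_gt0)).
  move=> x; rewrite /p /h /target_density /approx_density /patch.
  case: ifPn => [/set_mem Dx|_]; last by rewrite mulr0.
  exact: (scaled_ratio_le _ _ _ _ _ _ (ph_gt0 x) z_gt0 zhat_gt0 (W0 x Dx)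
    (le_trans (ratioM x Dx) (ler_norm _))).
have chi2E : chi2_div nu That_mu =
    (zhat / z ^+ 2 * I (fun x => target x / pihat g gamma x * target x) - 1)%:E.
  rewrite (chi2_div_density d nu That_mu p h nu_density That_density dom) EFinB.
  congr (_ - _)%E; rewrite -(integral_scaled _ _ intra).
  rewrite [RHS]integral_mkcond; apply: eq_integral => x _.
  rewrite /p /h /target_density /approx_density /patch.
  case: ifPn => [Dx|_]; last by rewrite mulr0.
  rewrite -/z -/zhat; congr _%:E.
  exact: (chi2_integrand _ _ _ _ _ (ph_gt0 x) z_gt0 zhat_gt0).
have mratio2 : measurable_fun D (fun x => target x ^+ 2 / pihat g gamma x ^+ 2).
  apply: measurable_funM; first exact: measurable_funX.
  by apply: measurable_funV; exact: measurable_funX.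
have ratio2_ge0 x : D x -> 0 <= target x ^+ 2 / pihat g gamma x ^+ 2.
  by move=> _; rewrite divr_ge0 ?sqr_ge0.
have nu_ratio : (\int[nu]_(x in box X) (target x ^+ 2 / pihat g gamma x ^+ 2)%:E)%E =
    (I (fun x => (target x / pihat g gamma x) ^+ 2 * target x) / z)%:E.
  rewrite (integral_density d nu p _ D nu_density mD mratio2 ratio2_ge0).
  rewrite [in RHS]mulrC -(integral_scaled _ _ intrra).
  apply: eq_integral => x Dx; rewrite /p /target_density patchE Dx -/z -/W.
  by congr _%:E; exact: (ratio2_integrand _ _ _ _ _ (ph_gt0 x)).
have That_ratio : (\int[That_mu]_(x in box X) (target x ^+ 2 / pihat g gamma x ^+ 2)%:E)%E =
    (I (fun x => (target x / pihat g gamma x) ^+ 2 * pihat g gamma x) / zhat)%:E.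
  rewrite (integral_density d That_mu h _ D That_density mD mratio2 ratio2_ge0).
  rewrite [in RHS]mulrC -(integral_scaled _ _ intrrp).
  apply: eq_integral => x Dx; rewrite /h /approx_density patchE Dx -/zhat -/W.
  by congr _%:E; exact: (ratio2_integrand _ _ _ _ _ (ph_gt0 x)).
rewrite chi2E nu_ratio That_ratio !poweR_EFin.
have I_ge0 F : (forall x, D x -> 0 <= F x) -> 0 <= I F.
  by move=> F0; apply: Rintegral_ge0 => x Dx; rewrite mulr_ge0 ?F0 ?W0.
rewrite powR12_sqrt; last first.
  apply: (fun H => divr_ge0 H (ltW z_gt0)); apply: I_ge0 => x Dx.
  exact: mulr_ge0 (sqr_ge0 _) (target_ge0 x Dx).
rewrite powR12_sqrt; last first.
  apply: (fun H => divr_ge0 H (ltW zhat_gt0)); apply: I_ge0 => x Dx.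
  exact: mulr_ge0 (sqr_ge0 _) (ltW (ph_gt0 x)).
rewrite -EFinD -EFinM lee_fin zhE zE.
apply: (chi2_bound m D mD W mW W0 target g gamma eps M mt mg target_ge0
  gamma_gt0 eps_ge0 int1 intt intg inte ratioM z_gt0 e_eps gamma_e).
Qed.
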